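(* Let $G$ be a non-bipartite quadrangulation of a non-orientable surface $S$ in which every $4$-cycle is facial. Then $\mathrm{cohom\text{-}ind}(\mathrm{L}(G))= 2$ if $G$ is odd, otherwise $\mathrm{cohom\text{-}ind}(\mathrm{L}(G))= 1$.
   Context: $\mathrm{L}(G)$ is the Lovász complex: the subcomplex of the barycentric subdivision of the neighborhood complex $\{A\subseteq V(G)\mid \mathrm{CN}(A)\neq\emptyset\}$ induced by the sets $A$ with $\mathrm{CN}^2(A)=A$ ($\mathrm{CN}$ = common neighbors), with its canonical free $\mathbb{Z}_2$-action. $\mathrm{cohom\text{-}ind}$ is the cohomological index (Stiefel–Whitney height), the height of the first Stiefel–Whitney class of the $\mathbb{Z}_2$-space. A quadrangulation of a non-orientable surface is odd if it contains an odd cycle whose cutting yields an orientable surface.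
   Formalization: In the definition of an odd quadrangulation, the odd cycle may repeat vertices and edges (a closed walk, with the cut taken along edges used an odd number of times); with vertex-simple cycles only, the ''otherwise'' case fails for some quadrangulations of surfaces of higher genus. *)

(* Defs.v *)
From mathcomp Require Import all_boot all_algebra.

Set Implicit Arguments.
Unset Strict Implicit.
Unset Printing Implicit Defensive.

Import GRing.Theory.

(** * Graphs *)

Record sgraph := SGraph {
  vert :> finType;
  adj : rel vert;
  adj_sym : symmetric adj;
  adj_irr : irreflexive adj }.

Definition bipartite (G : sgraph) : Prop :=
  exists col : G -> bool, forall u v : G, adj u v -> col u != col v.

(* A closed walk is the cyclic sequence of its vertices; its length is the
   size of the sequence. *)
Definition closed_walk (G : sgraph) (c : seq G) : bool := cycle (@adj G) c.

Definition graph_cycle (G : sgraph) (c : seq G) : bool :=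
  [&& closed_walk c, uniq c & 2 < size c].

Definition steps (T : eqType) (c : seq T) : seq (T * T) := zip c (rot 1 c).

Definition multiplicity (T : eqType) (c : seq T) (u v : T) : nat :=
  count [pred p | (p == (u, v)) || (p == (v, u))] (steps c).

Definition on_cycle (T : eqType) (c : seq T) (u v : T) : bool :=
  ((u, v) \in steps c) || ((v, u) \in steps c).

(** * Graphs embedded in closed surfaces *)

Section Surface.
Variables (G : sgraph) (F : finType) (bd : F -> seq G).

(* G is embedded in the connected closed surface obtained by gluing one
   polygon for each f : F along the cycle bd f of G.  The gluing is a surface
   iff each edge lies on two polygons and the polygons around each vertex
   form a single cyclic sequence (rather than several discs pinched together),
   i.e. the link of each vertex is connected. *)
Definition link (v : G) : rel G :=
  [rel u w | [exists f, on_cycle (bd f) u v && on_cycle (bd f) v w]].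

Record closed_surface : Prop := ClosedSurface {
  bd_cycle : forall f, graph_cycle (bd f);
  vert_face : forall v, exists f, v \in bd f;
  edge_faces : forall u v, adj u v -> #|[set f | on_cycle (bd f) u v]| = 2;
  link_connected :
    forall v u w, adj v u -> adj v w -> connect (link v) u w;
  surface_connected : forall u v, connect (@adj G) u v }.

Definition quadrangulation : Prop :=
  closed_surface /\ forall f, size (bd f) = 4.

(* o : F -> bool is a choice of orientations of the polygons (true for the
   direction in which bd f is listed).  The edge uv lies on two polygons, and
   their orientations agree across uv iff they induce opposite directions
   on uv. *)
Definition traverses (o : F -> bool) (f : F) (u v : G) : bool :=
  (if o f then (u, v) else (v, u)) \in steps (bd f).

Definition coherent (o : F -> bool) (u v : G) : bool :=
  [exists f, traverses o f u v] && [exists f, traverses o f v u].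

Definition orientable : Prop :=
  exists o : F -> bool, forall u v, adj u v -> coherent o u v.

(* Cutting along a simple cycle c of G leaves the polygons glued along the
   edges that are not on c. *)
Definition orientable_cut_cycle (c : seq G) : Prop :=
  exists o : F -> bool,
    forall u v, adj u v -> ~~ on_cycle c u v -> coherent o u v.

(* Cutting along a closed walk c, that is, along a closed curve that follows
   c: the orientations of the polygons are preserved or reversed across an
   edge according to the parity of the number of times c runs along it.  When
   c is a simple cycle of a non-orientable surface this is
   orientable_cut_cycle: see orientable_cutE. *)
Definition orientable_cut (c : seq G) : Prop :=
  exists o : F -> bool,
    forall u v, adj u v -> coherent o u v = ~~ odd (multiplicity c u v).

(* The odd cycle is allowed to repeat vertices.  On surfaces of large genus G
   need not contain any vertex-simple cycle whose cutting yields an orientable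
   surface, since such a cycle has to run through all the crosscaps. *)
Definition odd_quadrangulation : Prop :=
  exists c : seq G, [/\ closed_walk c, odd (size c) & orientable_cut c].

Definition facial (c : seq G) : Prop :=
  exists f, forall u v, on_cycle (bd f) u v = on_cycle c u v.

End Surface.

Section StepsTheory.
Variable T : finType.
Implicit Types (c : seq T) (s : seq (T * T)).

Lemma unzip1_steps c : unzip1 (steps c) = c.
Proof. by rewrite unzip1_zip // size_rot. Qed.

Lemma unzip2_steps c : unzip2 (steps c) = rot 1 c.
Proof. by rewrite unzip2_zip // size_rot. Qed.

Lemma steps_uniq c : uniq c -> uniq (steps c).
Proof. by rewrite -{1}(unzip1_steps c) => /map_uniq. Qed.

Lemma sum_fst s v : uniq (unzip1 s) ->
  \sum_(t : T) ((v, t) \in s) = (v \in unzip1 s).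
Proof.
elim: s => [_|[a b] s IH] /=; first by rewrite big1.
case/andP=> aNs /IH {}IH; rewrite inE.
under eq_bigr do rewrite inE xpair_eqE.
case: (eqVneq v a) => [->|_] /=; last exact: IH.
rewrite (bigD1 b) //= eqxx /= big1 ?addn0 // => t /negPf -> /=.
apply/eqP; rewrite eqb0; apply: contra aNs => ats.
by apply/mapP; exists (a, t).
Qed.

Lemma sum_snd s v : uniq (unzip2 s) ->
  \sum_(t : T) ((t, v) \in s) = (v \in unzip2 s).
Proof.
elim: s => [_|[a b] s IH] /=; first by rewrite big1.
case/andP=> bNs /IH {}IH; rewrite inE.
under eq_bigr do rewrite inE xpair_eqE andbC.
case: (eqVneq v b) => [->|_] /=; last exact: IH.
rewrite (bigD1 a) //= eqxx /= big1 ?addn0 // => t /negPf -> /=.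
apply/eqP; rewrite eqb0; apply: contra bNs => ats.
by apply/mapP; exists (t, b).
Qed.

Lemma stepsP c u v x0 : reflect
  (exists i, [/\ i < size c, u = nth x0 c i & v = nth x0 c (i.+1 %% size c)])
  ((u, v) \in steps c).
Proof.
have sz : size (steps c) = size c by rewrite size_zip size_rot minnn.
have nthS i : i < size c -> nth (x0, x0) (steps c) i =
    (nth x0 c i, nth x0 c (i.+1 %% size c)).
  move=> ic; rewrite nth_zip ?size_rot //; congr (_, _).
  case: c {sz} ic => [//|x s] /=; rewrite ltnS rot1_cons nth_rcons => ils.
  case: ltngtP ils => // [ils _|-> _]; last by rewrite modnn.
  by rewrite modn_small.
apply: (iffP (nthP (x0, x0))) => [[i]|[i [ic -> ->]]].
  by rewrite sz => ic; rewrite nthS // => -[<- <-]; exists i.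
by exists i; rewrite ?sz ?nthS.
Qed.

Lemma steps_asym c u v : uniq c -> 2 < size c ->
  (u, v) \in steps c -> (v, u) \notin steps c.
Proof.
move=> Uc gt2 h; apply/negP => h'.
have [i [ic eu ev]] := stepsP c u v u h.
have [j [jc ev' eu']] := stepsP c v u u h'.
have n0 : 0 < size c by case: (size c) gt2.
have /eqP := etrans (esym ev) ev'; rewrite nth_uniq ?ltn_mod // => /eqP ej.
have /eqP := etrans (esym eu) eu'; rewrite nth_uniq ?ltn_mod // => /eqP ei.
move: ei; rewrite -ej -addn1 modnDml addn1 -addn2 => /esym ei.
have : i + 2 = i + 0 %[mod size c] by rewrite ei addn0 modn_small.
by move/eqP; rewrite eqn_modDl mod0n modn_small.
Qed.

Lemma multiplicity_cycle c u v : uniq c -> 2 < size c -> u != v ->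
  multiplicity c u v = on_cycle c u v.
Proof.
move=> Uc gt2 uv; rewrite /multiplicity /on_cycle.
have -> : count [pred p | (p == (u, v)) || (p == (v, u))] (steps c) =
    count_mem (u, v) (steps c) + count_mem (v, u) (steps c).
  rewrite -count_predUI [X in _ + X](@eq_count _ _ pred0) ?count_pred0 ?addn0 //.
  by move=> [a b] /=; case: eqP => [[-> ->]|//]; rewrite xpair_eqE (negPf uv).
rewrite !count_uniq_mem ?steps_uniq //.
by case: ((u, v) \in _) / boolP => [/(steps_asym Uc gt2)/negPf -> //|_].
Qed.

End StepsTheory.

Section CutTheory.
Variables (G : sgraph) (F : finType) (bd : F -> seq G).
Hypothesis surf : closed_surface bd.
Variable o : F -> bool.

Let runs (u v : G) : nat := \sum_f traverses bd o f u v.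

Lemma step_adj (c : seq G) u v :
  closed_walk c -> (u, v) \in steps c -> adj u v.
Proof.
case: c => [//|x s] /=; rewrite /steps rot1_cons.
have -> : zip (x :: s) (rcons s x) = zip (belast x (rcons s x)) (rcons s x).
  by rewrite belast_rcons.
elim: (rcons s x) {1 3}x => [//|y p IH] z /= /andP[zy /IH {}IH].
by rewrite inE => /predU1P[[-> ->]|].
Qed.

Lemma runs_balance v : \sum_t runs t v = \sum_t runs v t.
Proof.
rewrite exchange_big [RHS]exchange_big /=; apply: eq_bigr => f _.
have /and3P[_ Uf _] := bd_cycle surf f; rewrite /traverses.
have h1 := sum_fst v (s := steps (bd f)).
have h2 := sum_snd v (s := steps (bd f)).
rewrite unzip1_steps in h1; rewrite unzip2_steps rot_uniq mem_rot in h2.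
by case: (o f); rewrite h1 ?h2.
Qed.

Lemma runs_nonadj u v : ~~ adj u v -> runs u v = 0.
Proof.
move=> uv; apply: big1 => f _; apply/eqP; rewrite eqb0; apply: contra uv.
have /and3P[wf _ _] := bd_cycle surf f; rewrite /traverses.
by case: (o f) => /(step_adj wf) //; rewrite adj_sym.
Qed.

Lemma runsD u v : adj u v -> runs u v + runs v u = 2.
Proof.
move=> uv; rewrite -(edge_faces surf uv) -sum1_card big_mkcond -big_split /=.
apply: eq_bigr => f _; rewrite inE /on_cycle /traverses.
have /and3P[_ Uf sf] := bd_cycle surf f.
have h := steps_asym (u := u) (v := v) Uf sf.
case: (o f); move: h; do 2![case: (_ \in _)] => //=; by move=> /(_ isT).
Qed.

Lemma runs_gt0 u v : [exists f, traverses bd o f u v] = (0 < runs u v).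
Proof.
rewrite lt0n sum_nat_eq0 negb_forall; apply: eq_existsb => f /=.
by rewrite eqb0 negbK.
Qed.

Lemma coherentE u v : adj u v -> coherent bd o u v = (runs u v == runs v u).
Proof.
move=> /runsD; rewrite /coherent !runs_gt0.
by case: (runs u v) => [|[|[|?]]] //; case: (runs v u) => [|[|[|?]]].
Qed.

Lemma coherent_sym u v : coherent bd o u v = coherent bd o v u.
Proof. exact: andbC. Qed.

Lemma coherent_turn u v w : adj v u -> adj v w -> u != w ->
  (forall t, adj v t -> t != u -> t != w -> coherent bd o v t) ->
  coherent bd o v u = coherent bd o v w.
Proof.
move=> vu vw uw coh; rewrite !coherentE //.
have D (a : G -> nat) : \sum_t a t =
    a u + (a w + \sum_(t | (t != u) && (t != w)) a t).
  by rewrite (bigD1 u) //= (bigD1 w) 1?eq_sym.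
have := runs_balance v; rewrite !D.
rewrite [X in _ + (_ + X)](eq_bigr (runs v)) => [/eqP|t /andP[tu tw]].
  rewrite !addnA eqn_add2r => /eqP e.
  by rewrite -(eqn_add2r (runs v w)) -e eqn_add2l eq_sym.
have [vt|Nvt] := boolP (adj v t); last by rewrite !runs_nonadj // adj_sym.
by apply/esym/eqP; rewrite -coherentE ?coh.
Qed.

Lemma coherent_cycle (c : seq G) : graph_cycle c ->
  (forall u v, adj u v -> ~~ on_cycle c u v -> coherent bd o u v) ->
  forall u v u' v', on_cycle c u v -> on_cycle c u' v' ->
  coherent bd o u v = coherent bd o u' v'.
Proof.
move=> /and3P[wc Uc gt2] coh.
have [x0 _] : exists x0 : G, true by case: (c) gt2 => // x; exists x.
pose n := size c; have n0 : 0 < n by rewrite /n; case: (size c) gt2.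
pose q i := nth x0 c (i %% n).
have stp i : (q i, q i.+1) \in steps c.
  apply/(stepsP _ _ _ x0); exists (i %% n); rewrite ltn_mod n0; split=> //.
  by rewrite /q -[in RHS]addn1 modnDml addn1.
have turn i : coherent bd o (q i) (q i.+1) = coherent bd o (q i.+1) (q i.+2).
  have a1 := step_adj wc (stp i); have a2 := step_adj wc (stp i.+1).
  rewrite coherent_sym; apply: coherent_turn => //; first by rewrite adj_sym.
    apply/eqP => e; have := steps_asym Uc gt2 (stp i).
    by rewrite [X in (_, X)]e stp.
  move=> t vt tu tw; apply: coh => //; apply/negP => /orP[] /(stepsP _ _ _ x0).
    case=> j [jc e1 e2]; case/eqP: tw; rewrite e2.
    move: e1 => /eqP; rewrite nth_uniq ?ltn_mod // => /eqP <-.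
    by rewrite /q -[in LHS]addn1 modnDml addn1.
  case=> j [jc e1 e2]; case/eqP: tu; rewrite e1 /q.
  move: e2 => /eqP; rewrite nth_uniq ?ltn_mod // => /eqP e2.
  have : i + 1 = j + 1 %[mod n] by rewrite !addn1.
  by move/eqP; rewrite eqn_modDr (modn_small jc) => /eqP ->.
have const i : coherent bd o (q i) (q i.+1) = coherent bd o (q 0) (q 1).
  by elim: i => // i <-; rewrite -turn.
have onq u v : on_cycle c u v -> coherent bd o u v = coherent bd o (q 0) (q 1).
  case/orP=> /(stepsP _ _ _ x0)[i [ic -> ->]]; last rewrite coherent_sym;
  by rewrite -(const i) /q (modn_small ic).
by move=> u v u' v' /onq -> /onq ->.
Qed.

End CutTheory.

Lemma orientable_cutE (G : sgraph) (F : finType) (bd : F -> seq G)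
    (c : seq G) : closed_surface bd -> ~ orientable bd -> graph_cycle c ->
  orientable_cut bd c <-> orientable_cut_cycle bd c.
Proof.
move=> surf nor Cc; have /and3P[_ Uc gt2] := Cc.
have mult u v : adj u v -> multiplicity c u v = on_cycle c u v.
  move=> uv; apply: multiplicity_cycle => //.
  by apply: contraTneq uv => ->; rewrite adj_irr.
split=> -[o ho]; exists o => u v uv.
  by move=> Nuv; rewrite ho // mult // (negPf Nuv).
rewrite mult // oddb; have [on|Non] := boolP (on_cycle c u v); last exact: ho.
apply/negP => cuv; apply: nor; exists o => u' v' uv'.
have [on'|] := boolP (on_cycle c u' v'); last exact: ho.
by rewrite (coherent_cycle surf Cc ho on' on).
Qed.

(** * Free simplicial Z_2-complexes *)

(* Not every point of the type zvert is a vertex: v is one iff [set v] is a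
   simplex.  The empty set counts as a simplex. *)
Record Z2complex := Z2Complex {
  zvert :> finType;
  simplex : {set {set zvert}};
  act : zvert -> zvert;
  simplex_sub : forall s t : {set zvert}, s \in simplex -> t \subset s -> t \in simplex;
  act_simplex : forall s : {set zvert}, s \in simplex -> act @: s \in simplex;
  actK : forall v : zvert, [set v] \in simplex -> act (act v) = v;
  act_free : forall s : {set zvert}, s \in simplex -> s != set0 -> act @: s != s }.

Section CohomologicalIndex.
Variable X : Z2complex.
Local Open Scope ring_scope.

(* The cohomology ring of the orbit space X/Z_2 with coefficients in F_2 is
   computed by the Z_2-invariant cochains on the ordered simplices of X
   (vertices may be repeated).  Only the values of a cochain on ordered
   simplices matter. *)
Definition osimplex n (x : {ffun 'I_n.+1 -> X}) : bool :=
  [set x i | i : 'I_n.+1] \in simplex X.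

Definition cochain n := {ffun 'I_n.+1 -> X} -> 'F_2.

Definition invariant_cochain n (a : cochain n) : Prop :=
  forall x, osimplex x -> a [ffun i => act (x i)] = a x.

Definition coboundary n (a : cochain n) : cochain n.+1 :=
  fun x => \sum_(i < n.+2) a [ffun j : 'I_n.+1 => x (lift i j)].

Definition cup p q (a : cochain p) (b : cochain q) : cochain (p + q) :=
  fun x => a [ffun i : 'I_p.+1 => x (inord i)]
           * b [ffun j : 'I_q.+1 => x (inord (p + j))].

Fixpoint cup_exp (a : cochain 1) n : cochain n :=
  if n is m.+1 then cup a (@cup_exp a m) else fun=> 1.
Arguments cup_exp : clear implicits.

Definition null_class n : cochain n -> Prop :=
  match n with
  | 0 => fun a => forall x, osimplex x -> a x = 0
  | m.+1 => fun a => exists2 b : cochain m, invariant_cochain b &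
                       forall x, osimplex x -> a x = coboundary b x
  end.

(* s is a Z_2-map from X to the infinite simplex with vertices in F_2 (a model
   of S^oo), where Z_2 acts by translation; a is the pull-back along s of the
   cocycle (i, j) |-> i + j that generates H^1(RP^oo; F_2). *)
Definition SW1_cocycle (a : cochain 1) : Prop :=
  exists2 s : X -> 'F_2,
    forall v, [set v] \in simplex X -> s (act v) = s v + 1 &
    forall x, osimplex x -> a x = s (x ord0) + s (x ord_max).

Definition cohom_ind_is (n : nat) : Prop :=
  exists2 w : cochain 1, SW1_cocycle w &
    ~ null_class (cup_exp w n) /\
    forall m, (n < m)%N -> null_class (cup_exp w m).

End CohomologicalIndex.

(** * The Lovász complex *)

Definition barycentric (T : finType) (K : {set {set T}}) : {set {set {set T}}} :=
  [set C : {set {set T}} | [forall A in C, (A != set0) && (A \in K)] &&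
    [forall A in C, forall B in C, (A \subset B) || (B \subset A)]].

Definition induced (T : finType) (K : {set {set T}}) (W : {set T}) :
  {set {set T}} := [set s in K | s \subset W].

Section Lovasz.
Variable G : sgraph.

Definition CN (A : {set G}) : {set G} := [set v | [forall u in A, adj u v]].

Definition neighborhood_complex : {set {set G}} := [set A | CN A != set0].

Definition lovasz_simplices : {set {set {set G}}} :=
  induced (barycentric neighborhood_complex) [set A | CN (CN A) == A].

Lemma lovaszP (C : {set {set G}}) : reflect
  ((forall A, A \in C -> [/\ A != set0, CN A != set0 & CN (CN A) = A]) /\
   (forall A B, A \in C -> B \in C -> (A \subset B) || (B \subset A)))
  (C \in lovasz_simplices).
Proof.
rewrite !inE -andbA; apply: (iffP and3P) => [[h1 h2 h3]|[h1 h2]]; split.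
- move=> A AC; move/forall_inP/(_ _ AC): h1; rewrite inE => /andP[? ?].
  by move/subsetP/(_ _ AC): h3; rewrite inE => /eqP.
- by move=> A B AC BC; move/forall_inP/(_ _ AC)/forall_inP/(_ _ BC): h2.
- by apply/forall_inP => A /h1[? ? _]; rewrite inE; apply/andP.
- by apply/forall_inP => A AC; apply/forall_inP => B BC; apply: h2.
- by apply/subsetP => A /h1[_ _ ?]; rewrite inE; apply/eqP.
Qed.

Lemma CN_sub (A B : {set G}) : A \subset B -> CN B \subset CN A.
Proof.
move=> /subsetP AB; apply/subsetP => v; rewrite !inE => /forall_inP h.
by apply/forall_inP => u /AB/h.
Qed.

Lemma CN_disjoint (A : {set G}) v : v \in A -> v \notin CN A.
Proof.
by move=> vA; rewrite inE; apply/negP => /forall_inP/(_ _ vA); rewrite adj_irr.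
Qed.

Lemma lovasz_sub (s t : {set {set G}}) :
  s \in lovasz_simplices -> t \subset s -> t \in lovasz_simplices.
Proof.
move=> /lovaszP[h1 h2] /subsetP ts; apply/lovaszP; split=> [A /ts /h1 //|].
by move=> A B /ts + /ts; apply: h2.
Qed.

Lemma lovasz_act (s : {set {set G}}) :
  s \in lovasz_simplices -> CN @: s \in lovasz_simplices.
Proof.
move=> /lovaszP[h1 h2]; apply/lovaszP; split=> [_ /imsetP[A /h1[? ? e] ->]|].
  by rewrite !e.
move=> _ _ /imsetP[A As ->] /imsetP[B Bs ->].
by case/orP: (h2 _ _ As Bs) => /CN_sub ->; rewrite ?orbT.
Qed.

Lemma lovasz_actK (A : {set G}) :
  [set A] \in lovasz_simplices -> CN (CN A) = A.
Proof. by case/lovaszP=> /(_ A (set11 A))[]. Qed.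

Lemma lovasz_free (s : {set {set G}}) :
  s \in lovasz_simplices -> s != set0 -> CN @: s != s.
Proof.
move=> /lovaszP[h1 h2] /set0Pn[A As]; apply/eqP => e.
have CAs : CN A \in s by rewrite -e imset_f.
have [/set0Pn[v vA] /set0Pn[w wA] _] := h1 _ As.
case/orP: (h2 _ _ As CAs) => /subsetP h.
  by move: (CN_disjoint vA); rewrite h.
by move: (CN_disjoint (h _ wA)); rewrite wA.
Qed.

Definition lovasz : Z2complex :=
  Z2Complex lovasz_sub lovasz_act lovasz_actK lovasz_free.

End Lovasz.

(* Main.v *)
Require Import Defs.
From mathcomp Require Import all_boot all_algebra zify.

Set Implicit Arguments.
Unset Strict Implicit.
Unset Printing Implicit Defensive.

Import GRing.Theory.

(** Let w be the first Stiefel-Whitney cocycle of L(G).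

    The square of w is a coboundary iff w = c + nu c for a (non-invariant)
    1-cocycle c of L(G), where nu is the involution, and such a c amounts to an
    orientation of the edges of G in which each 4-cycle has an even number of
    forward edges.  As the 4-cycles are the faces, this is a system of linear
    equations over F_2, one for each face.  Choose orientations of the faces
    and add up the equations: an edge at which the orientations agree is
    counted once in each direction, and the number of edges is even, so the
    system requires the number of incoherent edges to be even.  Conversely
    this suffices, because the dual graph is connected.  The incoherent edges
    have even degree at each vertex, hence they are the edges used an odd
    number of times by a closed walk, whose length has the parity of their
    number; so the system is solvable iff G is not odd.

    As G is not bipartite, w is not a coboundary and G contains no K_{2,3};
    the latter makes L(G) two-dimensional, so that w^3 is a coboundary. *)

(** * Powers of the Stiefel-Whitney cocycle *)

Section F2.
Local Open Scope ring_scope.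

Definition bit (x : 'F_2) : bool := x != 0.

Lemma bit_inj : injective bit.
Proof. by move=> [[|[|n]] hn] [[|[|m]] hm] //= _; apply: val_inj. Qed.

Lemma bitD x y : bit (x + y) = bit x (+) bit y.
Proof. by case: x y => [[|[|n]] hn] [[|[|m]] hm]. Qed.

Lemma bitM x y : bit (x * y) = bit x && bit y.
Proof. by case: x y => [[|[|n]] hn] [[|[|m]] hm]. Qed.

Lemma bit_nat (b : bool) : bit b%:R = b.
Proof. by case: b. Qed.

Lemma bit_sum (I : Type) (r : seq I) (P : pred I) (E : I -> 'F_2) :
  bit (\sum_(i <- r | P i) E i) = \big[addb/false]_(i <- r | P i) bit (E i).
Proof. exact: (big_morph bit bitD). Qed.

End F2.

Section SWPowers.
Variables (X : Z2complex) (s : X -> bool).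
Hypothesis s_act : forall v, [set v] \in simplex X -> s (act v) = ~~ s v.
Local Open Scope ring_scope.

Definition SW1 : cochain X 1 :=
  fun x => (s (x ord0) (+) s (x ord_max))%:R.

Local Notation SWpow n := (@cup_exp X SW1 n).

Lemma SW1P : SW1_cocycle SW1.
Proof.
exists (fun v => (s v)%:R) => [v /s_act ->|x _]; apply: bit_inj;
by rewrite bitD !bit_nat ?addbT.
Qed.

Lemma osimplex_vertex n (x : {ffun 'I_n.+1 -> X}) i :
  osimplex x -> [set x i] \in simplex X.
Proof.
by move=> /simplex_sub; apply; rewrite sub1set; apply/imsetP; exists i.
Qed.

Lemma osimplex_face n m (x : {ffun 'I_n.+1 -> X}) (f : 'I_m.+1 -> 'I_n.+1) :
  osimplex x -> osimplex [ffun i => x (f i)].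
Proof.
move=> /simplex_sub; apply; apply/subsetP => _ /imsetP[i _ ->].
by rewrite ffunE; apply/imsetP; exists (f i).
Qed.

Lemma cup_SW1 n (b : cochain X n) x :
  cup SW1 b x = (s (x (inord 0)) (+) s (x (inord 1)))%:R *
                b [ffun j : 'I_n.+1 => x (lift ord0 j)].
Proof.
rewrite /cup /SW1 !ffunE; congr (_ * b _).
apply/ffunP => j; rewrite !ffunE; congr (x _); apply: val_inj.
by rewrite /= inordK // ltnS; apply: ltn_ord j.
Qed.

(** As w is a cocycle, w^(m+1) = db gives w^(m+2) = w ∪ db = d(w ∪ b) over F_2. *)
Lemma null_cup_expS m :
  null_class (SWpow m.+1) -> null_class (SWpow m.+2).
Proof.
case=> b binv hb; exists (cup SW1 b) => [x ox|x ox].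
  rewrite !cup_SW1 !ffunE !s_act ?osimplex_vertex // addNb addbN negbK.
  congr (_ * _); rewrite -[RHS]binv ?osimplex_face //.
  by congr b; apply/ffunP => j; rewrite !ffunE.
have -> : SWpow m.+2 x = cup SW1 (SWpow m.+1) x by [].
rewrite cup_SW1 hb ?osimplex_face // /coboundary.
rewrite big_ord_recl [RHS]big_ord_recl [X in _ = _ + X]big_ord_recl !cup_SW1.
rewrite mulrDr mulr_sumr addrA; congr (_ + _).
  (* Omitting vertex 0 or vertex 1 of [x] leaves the same argument for [b]; the two coefficients add
     up to w on the first edge by the cocycle identity. *)
  rewrite !ffunE.
  have -> : lift ord0 (inord 0 : 'I_(1 + m).+1) = inord 1 :> 'I_m.+3.
    by apply: val_inj; rewrite /= !inordK.
  have -> : lift ord0 (inord 1 : 'I_(1 + m).+1) = inord 2 :> 'I_m.+3.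
    by apply: val_inj; rewrite /= !inordK.
  have -> : lift (lift ord0 ord0) (inord 0 : 'I_(1 + m).+1) = inord 0 :> 'I_m.+3.
    by apply: val_inj; rewrite /= !inordK.
  have -> : lift (lift ord0 ord0) (inord 1 : 'I_(1 + m).+1) = inord 2 :> 'I_m.+3.
    by apply: val_inj; rewrite /= !inordK.
  set b0 := b _; set b1 := b _.
  have -> : b1 = b0.
    by congr b; apply/ffunP => j; rewrite !ffunE; congr (x _); apply: val_inj.
  rewrite -mulrDl; congr (_ * _); apply: bit_inj; rewrite bitD !bit_nat.
  by do 3![case: (s _)].
apply: eq_bigr => i _; rewrite cup_SW1 !ffunE.
have -> : lift (lift ord0 (lift ord0 i)) (inord 0 : 'I_(1 + m).+1) = inord 0 :> 'I_m.+3.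
  by apply: val_inj; rewrite /= !inordK.
have -> : lift (lift ord0 (lift ord0 i)) (inord 1 : 'I_(1 + m).+1) = inord 1 :> 'I_m.+3.
  by apply: val_inj; rewrite /= !inordK.
congr (_ * b _); apply/ffunP => j; rewrite !ffunE; congr (x _).
apply: val_inj; rewrite /= /bump; lia.
Qed.

Lemma bit_cup_exp n (x : {ffun 'I_n.+1 -> X}) :
  bit (SWpow n x) =
  all (fun i => s (x (inord i)) (+) s (x (inord i.+1))) (iota 0 n).
Proof.
elim: n x => [|n IH] x //.
have -> : SWpow n.+1 x = cup SW1 (SWpow n) x by [].
rewrite cup_SW1 bitM bit_nat IH /=; congr (_ && _).
rewrite -[1%N]/(1 + 0)%N iotaDl all_map; apply: eq_in_all => i.
rewrite mem_iota add0n => /andP[_ ltin] /=; rewrite !ffunE.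
by congr (s (x _) (+) s (x _)); apply: val_inj; rewrite /= !inordK //; lia.
Qed.

Definition oseq n (x0 : X) (xs : seq X) : {ffun 'I_n.+1 -> X} :=
  [ffun i : 'I_n.+1 => nth x0 xs i].

Lemma osimplex_oseq n x0 xs (A : {set X}) : size xs = n.+1 ->
  A \in simplex X -> {subset xs <= A} -> osimplex (oseq n x0 xs).
Proof.
move=> sz As sub; apply: (simplex_sub As); apply/subsetP => _ /imsetP[i _ ->].
by rewrite ffunE; apply/sub/mem_nth; rewrite sz.
Qed.

Lemma bit_coboundary n (b : cochain X n) x :
  bit (coboundary b x) =
  \big[addb/false]_(i < n.+2) bit (b [ffun j : 'I_n.+1 => x (lift i j)]).
Proof. exact: bit_sum. Qed.

Lemma osimplex_in n (x : {ffun 'I_n.+1 -> X}) (i : 'I_n.+1) :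
  x i \in [set x i | i : 'I_n.+1].
Proof. by apply/imsetP; exists i. Qed.

(** The primitive of w, read as a function t on vertices, makes s + t a Z_2-map from X to two
    points. *)
Lemma null_SW1_potential : null_class (SWpow 1) ->
  exists t : X -> bool,
    (forall v, [set v] \in simplex X -> t (act v) = t v) /\
    (forall x y, [set x; y] \in simplex X -> s x (+) s y = t x (+) t y).
Proof.
case=> b binv hb; exists (fun v => bit (b [ffun=> v])); split=> [v vX|x y xy].
  rewrite -(binv [ffun=> v]); last first.
    apply: (simplex_sub vX); apply/subsetP => _ /imsetP[i _ ->].
    by rewrite ffunE set11.
  by congr (bit (b _)); apply/ffunP => i; rewrite !ffunE.
have o : osimplex (oseq 1 x [:: x; y]).
  by apply: osimplex_oseq xy _ => // z; rewrite !inE.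
have := congr1 bit (hb _ o); rewrite bit_cup_exp bit_coboundary.
rewrite !big_ord_recl big_ord0 /= !ffunE !inordK //= andbT addbF => ->.
rewrite addbC; congr (bit (b _) (+) bit (b _)); apply/ffunP => i; rewrite !ffunE;
by rewrite (ord1 i).
Qed.

(** The second condition, c + nu c = w, makes w the transfer of c; in the Gysin sequence of X ->
    X/Z_2 the image of the transfer is the kernel of multiplication by w. *)
Definition transfer_cocycle (c : X -> X -> bool) : Prop :=
  (forall x y z, [set x; y; z] \in simplex X -> c x y (+) c y z = c x z) /\
  (forall x y, [set x; y] \in simplex X ->
     c (act x) (act y) = c x y (+) s x (+) s y).

(* The cochain s x (1 + s y) is a non-invariant primitive of w^2. *)
Lemma null_SW1_square :
  null_class (SWpow 2) <-> exists c, transfer_cocycle c.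
Proof.
split=> [[b binv hb]|[c [cZ cact]]].
  exists (fun x y => bit (b (oseq 1 x [:: x; y])) (+) s x && ~~ s y).
  split=> [x y z xyz|x y xy].
    have o : osimplex (oseq 2 x [:: x; y; z]).
      by apply: osimplex_oseq xyz _ => // t; rewrite !inE orbA.
    have := congr1 bit (hb _ o); rewrite bit_cup_exp bit_coboundary.
    rewrite !big_ord_recl big_ord0 /= !ffunE !inordK //= andbT addbF.
    set b0 := b _; set b1 := b _; set b2 := b _.
    set b3 := b _; set b4 := b _; set b5 := b _.
    have -> : b0 = b4.
      by congr b; apply/ffunP => -[[|[|]]] // ?; rewrite !ffunE.
    have -> : b1 = b5.
      by congr b; apply/ffunP => -[[|[|]]] // ?; rewrite !ffunE.
    have -> : b2 = b3.
      by congr b; apply/ffunP => -[[|[|]]] // ?; rewrite !ffunE.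
    by do 3!case: (bit _); do 3!case: (s _).
  have o : osimplex (oseq 1 x [:: x; y]).
    by apply: osimplex_oseq xy _ => // t; rewrite !inE.
  have xX : [set x] \in simplex X by rewrite (simplex_sub xy) // subsetUl.
  have yX : [set y] \in simplex X by rewrite (simplex_sub xy) // subsetUr.
  rewrite !s_act // -(binv _ o).
  have -> : [ffun i => act (oseq 1 x [:: x; y] i)] = oseq 1 (act x) [:: act x; act y].
    by apply/ffunP => -[[|[|]]] // ?; rewrite !ffunE.
  by case: (bit _); do 2!case: (s _).
exists (fun x => (c (x (inord 0)) (x (inord 1)) (+)
                  s (x (inord 0)) && ~~ s (x (inord 1)))%:R) => x ox.
  have xy : [set x (inord 0); x (inord 1)] \in simplex X.
    apply: (simplex_sub ox); apply/subsetP => _ /set2P[]->; exact: osimplex_in.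
  rewrite !ffunE cact // !s_act ?osimplex_vertex //.
  by case: (c _ _); do 2!case: (s _).
apply: bit_inj; rewrite bit_cup_exp bit_coboundary.
rewrite !big_ord_recl big_ord0 !bit_nat !ffunE /= andbT addbF.
have e (i : 'I_3) (j : 'I_2) k : bump i j = k -> lift i j = inord k.
  by move=> <-; rewrite -[bump i j]/(val (lift i j)) inord_val.
rewrite !(e ord0 (inord 0) 1) ?(e ord0 (inord 1) 2%N) ?inordK //.
rewrite !(e (lift ord0 ord0) (inord 0) 0)
        ?(e (lift ord0 ord0) (inord 1) 2%N) ?inordK //.
rewrite !(e (lift ord0 (lift ord0 ord0)) (inord 0) 0)
        ?(e (lift ord0 (lift ord0 ord0)) (inord 1) 1) ?inordK //.
rewrite -(cZ (x (inord 0)) (x (inord 1))); last first.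
  apply: (simplex_sub ox); apply/subsetP => z; rewrite !inE => /orP[/orP[]|] /eqP ->;
  exact: osimplex_in.
by do 2!case: (c _ _); do 3!case: (s _).
Qed.

End SWPowers.

Ltac bool_cases := repeat match goal with b : bool |- _ => destruct b end.

(* A vertex is recorded as a pair of its sign and the rank of its orbit, and
   nu flips the sign.  Sorting the vertices by rank turns w^2, by adding the
   coboundary of the invariant cochain [ascent], into a cocycle w' that vanishes
   on degenerate simplices, and w' = q + nu q for the alternating cochain
   q = [sorted_peak].  In dimension 2, q is a cocycle; as w is the coboundary of
   the sign s and s + nu s = 1, the cube of w is the coboundary of the invariant
   cochain w [ascent] + s w' + q. *)
Section SortedPrimitive.
Implicit Types p q r : bool * nat.

Definition peak p q r : bool :=
  [&& p.2 < q.2, q.2 < r.2, ~~ p.1, q.1 & ~~ r.1].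

Definition sorted_peak p q r : bool :=
  peak p q r (+) peak p r q (+) peak q p r (+) peak q r p (+) peak r p q
  (+) peak r q p.

Definition alternates p q r : bool := (p.1 (+) q.1) && (q.1 (+) r.1).

Definition ascent p q : bool := (p.1 (+) q.1) && (p.2 < q.2).

Definition sorted_alternates p q r : bool :=
  alternates p q r (+) ascent p q (+) ascent q r (+) ascent p r.

Definition cube_primitive p q r : bool :=
  (p.1 (+) q.1) && ascent q r (+) p.1 && sorted_alternates p q r
  (+) sorted_peak p q r.

Definition flip p := (~~ p.1, p.2).

(** Holds for two vertices of a simplex: equal ranks put them in one orbit, and no simplex contains
    two vertices of one orbit. *)
Definition separated p q := p.2 = q.2 -> p.1 = q.1.

Lemma cube_primitive_flip p q r :
  separated p q -> separated q r -> separated p r ->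
  cube_primitive (flip p) (flip q) (flip r) = cube_primitive p q r.
Proof.
case: p q r => [sp p] [sq q] [sr r]; rewrite /separated /= => pq qr pr.
rewrite /cube_primitive /sorted_alternates /sorted_peak /peak /alternates /ascent /=.
case: (ltngtP p q) => [?|?|e]; [| |move: (pq e) => ?];
case: (ltngtP q r) => [?|?|e']; try move: (qr e') => ?;
case: (ltngtP p r) => [?|?|e'']; try (exfalso; lia); try move: (pr e'') => ?; subst;
by bool_cases.
Qed.

(** The coincidence of two ranks is what dimension 2 provides; with it the coboundary of
    [sorted_peak] vanishes. The possible orders of the ranks are enumerated. *)
Lemma cube_primitive_coboundary p q r t :
  separated p q -> separated p r -> separated p t ->
  separated q r -> separated q t -> separated r t ->
  [|| p.2 == q.2, p.2 == r.2, p.2 == t.2, q.2 == r.2, q.2 == t.2 | r.2 == t.2] ->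
  cube_primitive q r t (+) (cube_primitive p r t (+)
    (cube_primitive p q t (+) cube_primitive p q r)) =
  [&& p.1 (+) q.1, q.1 (+) r.1 & r.1 (+) t.1].
Proof.
case: p q r t => [sp p] [sq q] [sr r] [st t]; rewrite /separated /=.
rewrite /cube_primitive /sorted_alternates /sorted_peak /peak /alternates /ascent /=.
move=> pq pr pt qr qt rt.
case/or4P=> [/eqP e|/eqP e|/eqP e|/or3P[] /eqP e]; subst;
[move: (pq erefl)|move: (pr erefl)|move: (pt erefl)
 |move: (qr erefl)|move: (qt erefl)|move: (rt erefl)] => e; subst; rewrite !ltnn.
all: repeat match goal with |- context [leq (S ?a) ?b] =>
   case: (ltngtP a b) => ?; try (exfalso; lia) end.
all: repeat match goal with
   | e : ?a = ?b :> nat, h : ?a = ?b -> _ |- _ => move: (h e) => {}h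
   | e : ?a = ?b :> nat, h : ?b = ?a -> _ |- _ => move: (h (esym e)) => {}h end; subst.
all: by bool_cases.
Qed.
End SortedPrimitive.

(** * Ranks of vertex orbits *)

Section OrbitRank.
Variable X : Z2complex.

Definition orbit_rank (v : X) : nat :=
  minn (enum_rank v) (enum_rank (act v)).

Lemma orbit_rank_act v :
  [set v] \in simplex X -> orbit_rank (act v) = orbit_rank v.
Proof. by move=> vX; rewrite /orbit_rank actK // minnC. Qed.

(** The involution would map this simplex to itself, against freeness. *)
Lemma act_not_in_simplex v : [set v; act v] \notin simplex X.
Proof.
apply/negP => vX; have v1 : [set v] \in simplex X.
  by rewrite (simplex_sub vX) // subsetUl.
have v0 : [set v; act v] != set0 by apply/set0Pn; exists v; rewrite set21.
by have := act_free vX v0; rewrite imsetU1 imset_set1 actK // setUC eqxx.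
Qed.

Lemma orbit_rank_inj x y :
  [set x; y] \in simplex X -> orbit_rank x = orbit_rank y -> x = y.
Proof.
move=> xy; have xX : [set x] \in simplex X by rewrite (simplex_sub xy) // subsetUl.
have yX : [set y] \in simplex X by rewrite (simplex_sub xy) // subsetUr.
have rk (u v : X) : enum_rank u = enum_rank v :> nat -> u = v.
  by move/val_inj/enum_rank_inj.
(* Equal minima force one of four coincidences between the two orbits; the mixed ones would put a
   vertex and its image in one simplex. *)
have : [|| x == y, x == act y, act x == y | act x == act y] -> x = y.
  case/or4P=> /eqP e //.
  - by move: xy (act_not_in_simplex y); rewrite e setUC => ->.
  - by move: xy (act_not_in_simplex x); rewrite -e => ->.
  - by rewrite -[x](actK xX) e actK.
move=> h e; apply: h; move: e; rewrite /orbit_rank /minn.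
by case: ifP => _; case: ifP => _ /rk ->; rewrite eqxx ?orbT.
Qed.

End OrbitRank.

(** * Vanishing of the third power in dimension two *)

Section SWCube.
Variables (X : Z2complex) (s : X -> bool).
Hypothesis s_act : forall v, [set v] \in simplex X -> s (act v) = ~~ s v.
Hypothesis dim2 : forall A, A \in simplex X -> #|A| <= 3.
Local Open Scope ring_scope.

Let mark (v : X) := (s v, orbit_rank v).

Lemma separated_mark n (x : {ffun 'I_n.+1 -> X}) i j :
  osimplex x -> separated (mark (x i)) (mark (x j)).
Proof.
move=> ox /orbit_rank_inj -> //.
apply: (simplex_sub ox); apply/subsetP => _ /set2P[]->; exact: osimplex_in.
Qed.

Lemma null_SW1_cube : null_class (@cup_exp X (SW1 s) 3).
Proof.
pose b (x : {ffun 'I_3 -> X}) := cube_primitive (mark (x (inord 0)))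
  (mark (x (inord 1))) (mark (x (inord 2))).
exists (fun x => (b x)%:R) => x ox.
  congr (_ _)%:R; rewrite /b -[RHS]cube_primitive_flip; try exact: separated_mark.
  by rewrite !ffunE /flip /mark /= !s_act ?orbit_rank_act ?osimplex_vertex.
apply: bit_inj; rewrite bit_cup_exp bit_coboundary.
rewrite !big_ord_recl big_ord0 !bit_nat /b !ffunE /= andbT addbF.
have e (i : 'I_4) (j : 'I_3) k : bump i j = k -> lift i j = inord k.
  by move=> <-; rewrite -[bump i j]/(val (lift i j)) inord_val.
rewrite !(e ord0 (inord 0) 1%N) ?(e ord0 (inord 1) 2%N)
  ?(e ord0 (inord 2) 3%N) ?inordK //.
rewrite !(e (lift ord0 ord0) (inord 0) 0%N) ?(e (lift ord0 ord0) (inord 1) 2%N)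
  ?(e (lift ord0 ord0) (inord 2) 3%N) ?inordK //.
rewrite !(e (lift ord0 (lift ord0 ord0)) (inord 0) 0%N)
  ?(e (lift ord0 (lift ord0 ord0)) (inord 1) 1%N)
  ?(e (lift ord0 (lift ord0 ord0)) (inord 2) 3%N) ?inordK //.
rewrite !(e (lift ord0 (lift ord0 (lift ord0 ord0))) (inord 0) 0%N)
  ?(e (lift ord0 (lift ord0 (lift ord0 ord0))) (inord 1) 1%N)
  ?(e (lift ord0 (lift ord0 (lift ord0 ord0))) (inord 2) 2%N) ?inordK //.
rewrite cube_primitive_coboundary //; try exact: separated_mark.
(* Four entries from a simplex with at most three vertices must repeat, which yields the two equal
   ranks. *)
have : ~~ injectiveb x.
  apply: contraL (dim2 ox) => /injectiveP xi.
  by rewrite -ltnNge card_imset // card_ord.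
case/injectivePn=> i [j ij eij].
have {ij} : exists i j, [/\ (i < j)%N, (j < 4)%N & x (inord i) = x (inord j)].
  case: (ltngtP i j) => [lt|lt|/val_inj ei]; last by rewrite ei eqxx in ij.
    by exists i, j; rewrite !inord_val ltn_ord.
  by exists j, i; rewrite !inord_val ltn_ord.
rewrite /mark /= => -[{eij}i [{}j [ij j4 eij]]].
by case: j ij j4 eij => [|[|[|[|]]]] //; case: i => [|[|[|]]] // _ _ ->;
  rewrite eqxx ?orbT.
Qed.

Lemma null_SW1_ge3 m : (2 < m)%N -> null_class (@cup_exp X (SW1 s) m).
Proof.
case: m => [|[|[|m]]] // _; elim: m => [|m IH]; first exact: null_SW1_cube.
exact: null_cup_expS.
Qed.

End SWCube.

(** * Edge orientations and the Lovász complex *)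

Definition edge_orientation (G : sgraph) (g : G -> G -> bool) : Prop :=
  forall u v, adj u v -> g v u = ~~ g u v.

(** For an edge orientation this says that the closed walk a b a' b' has an even number of forward
    edges: the two edges run from b to a' and from b' to a contribute two negations, which
    cancel. *)
Definition balanced (G : sgraph) (g : G -> G -> bool) : Prop :=
  forall a a' b b', adj a b -> adj a b' -> adj a' b -> adj a' b' ->
  g a b (+) g a b' = g a' b (+) g a' b'.

Definition no_K23 (G : sgraph) : Prop :=
  forall A B : {set G}, 2 <= #|A| -> 3 <= #|B| -> ~~ (B \subset CN A).

Section LovaszIndex.
Variable G : sgraph.
Implicit Types (A B C : {set G}) (u v a b : G).

Lemma in_CN A u v : u \in A -> v \in CN A -> adj u v.
Proof. by move=> uA; rewrite inE => /forall_inP/(_ _ uA). Qed.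

Lemma mem_CN1 u v : (u \in CN [set v]) = adj v u.
Proof.
rewrite inE; apply/forall_inP/idP => [/(_ v (set11 v))//|vu w].
by move/set1P->.
Qed.

Lemma sub_CN2 A : A \subset CN (CN A).
Proof.
apply/subsetP => u uA; rewrite inE; apply/forall_inP => v /(in_CN uA).
by rewrite adj_sym.
Qed.

Lemma CN3 A : CN (CN (CN A)) = CN A.
Proof. by apply/eqP; rewrite eqEsubset sub_CN2 CN_sub ?sub_CN2. Qed.

(** One side of a maximal complete bipartite subgraph, [CN A] being the other; these are the
    vertices of L(G). *)
Definition concept A : Prop := [/\ A != set0, CN A != set0 & CN (CN A) = A].

Lemma lovasz_vertexP A : [set A] \in simplex (lovasz G) <-> concept A.
Proof.
split=> [/lovaszP[/(_ A (set11 A))]//|h]; apply/lovaszP.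
by split=> [B /set1P->|B C /set1P-> /set1P->] //; rewrite subxx.
Qed.

Lemma lovasz_chain3 A B C : concept A -> concept B -> concept C ->
  A \subset B -> B \subset C -> [set A; B; C] \in simplex (lovasz G).
Proof.
move=> hA hB hC AB BC; apply/lovaszP; split=> [D|D E].
  by rewrite !inE -orbA => /or3P[] /eqP ->.
rewrite !inE -!orbA => /or3P[] /eqP -> /or3P[] /eqP ->;
by rewrite ?subxx ?AB ?BC ?orbT ?(subset_trans AB BC) ?orbT.
Qed.

Lemma lovasz_chain2 A B : concept A -> concept B ->
  A \subset B -> [set A; B] \in simplex (lovasz G).
Proof.
move=> hA hB AB; have := lovasz_chain3 hA hB hB AB (subxx B).
by rewrite -setUA setUid.
Qed.

Lemma concept_CN A : concept A -> concept (CN A).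
Proof. by case=> A0 CA0 e; split=> //; rewrite e. Qed.

Lemma concept_closure A : A != set0 -> CN A != set0 -> concept (CN (CN A)).
Proof.
move=> /set0Pn[u uA] CA; split; rewrite ?CN3 //.
by apply/set0Pn; exists u; rewrite (subsetP (sub_CN2 A)).
Qed.

(** * From cochains on L(G) to colourings and orientations of G *)

Section EquivariantFunction.
Variable s : {set G} -> bool.
Hypothesis s_act : forall A : lovasz G,
  [set A] \in simplex (lovasz G) -> s (@act (lovasz G) A) = ~~ s A.

Lemma s_CN A : concept A -> s (CN A) = ~~ s A.
Proof. by move=> /lovasz_vertexP; apply: s_act. Qed.

Lemma concept_nbhd u v : adj u v -> concept (CN [set v]).
Proof.
move=> uv; rewrite -CN3; apply: concept_closure.
  by apply/set0Pn; exists u; rewrite mem_CN1 adj_sym.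
by apply/set0Pn; exists v; rewrite (subsetP (sub_CN2 _)) ?set11.
Qed.

(** This inclusion is the simplex of L(G) representing the directed edge uv; the involution takes it
    to the one of vu. *)
Lemma closure1_sub_nbhd u v : adj u v -> CN (CN [set u]) \subset CN [set v].
Proof.
move=> uv; rewrite -[CN [set v]]CN3; apply/CN_sub/CN_sub.
by rewrite sub1set mem_CN1 adj_sym.
Qed.

(** The function s + t is equal at the ends of the simplex of uv and opposite at [CN [set u]] and
    its image, so its values at neighbourhoods of vertices colour G. *)
Lemma null_SW1_bipartite :
  null_class (@cup_exp (lovasz G) (SW1 (X := lovasz G) s) 1) -> bipartite G.
Proof.
case/null_SW1_potential => t [t_act ts].
exists (fun v => s (CN [set v]) (+) t (CN [set v])) => u v uv.
have vu : adj v u by rewrite adj_sym.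
have hv := concept_nbhd uv; have hu := concept_nbhd vu.
have hu2 := concept_CN hu.
have := ts _ _ (lovasz_chain2 hu2 hv (closure1_sub_nbhd uv)).
have -> : t (CN (CN [set u])) = t (CN [set u]).
  by apply: t_act; apply/lovasz_vertexP.
rewrite (s_CN hu).
by do 2!case: (s _); do 2!case: (t _).
Qed.

Lemma null_SW1_square_orientation :
  null_class (@cup_exp (lovasz G) (SW1 (X := lovasz G) s) 2) ->
  exists2 g : G -> G -> bool, edge_orientation g & balanced g.
Proof.
move=> /(null_SW1_square s_act)[c [cZ cact]].
have c0 A : concept A -> c A A = false.
  move=> hA; have := cZ A A A; rewrite !setUid => /(_ _)<-; first exact: addbb.
  exact/lovasz_vertexP.
have csym A B : concept A -> concept B -> A \subset B -> c B A = c A B.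
  move=> hA hB AB; have := cZ A B A.
  rewrite (setUC [set A; B]) setUA setUid c0 // => /(_ (lovasz_chain2 hA hB AB)).
  by case: (c A B); case: (c B A).
(* The involution takes the simplex of ab to that of ba, changing c by s at its two ends; the added
   term s makes the total change 1. *)
exists (fun a b => c (CN (CN [set a])) (CN [set b]) (+) s (CN [set b])).
  move=> u v uv; have vu : adj v u by rewrite adj_sym.
  have hv := concept_nbhd uv; have hu := concept_nbhd vu.
  have uv2 := closure1_sub_nbhd uv.
  have := cact _ _ (lovasz_chain2 (concept_CN hu) hv uv2).
  rewrite /= CN3 csym //; [|exact: concept_CN|exact: closure1_sub_nbhd].
  move=> ->; rewrite s_CN //.
  by case: (c _ _); do 2!case: (s _).
move=> a a' b b' ab ab' a'b a'b'.
(* [D] lies between the two ends of the simplex of each of the four edges, so c splits into a part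
   depending on a or a' and a part depending on b or b'; these cancel around the 4-cycle. *)
pose D := CN (CN [set a; a']).
have hD : concept D.
  apply: concept_closure; apply/set0Pn; first by exists a; rewrite set21.
  by exists b; rewrite inE; apply/forall_inP => _ /set2P[]->.
have aD u v : u \in [set a; a'] -> adj u v ->
    concept (CN (CN [set u])) /\ CN (CN [set u]) \subset D.
  move=> uaa uv; split; last by apply/CN_sub/CN_sub; rewrite sub1set.
  by apply/concept_CN/(@concept_nbhd v); rewrite adj_sym.
have bD v : adj a v -> adj a' v -> concept (CN [set v]) /\ D \subset CN [set v].
  move=> av a'v; split; first exact: concept_nbhd av.
  rewrite /D -[CN [set v]]CN3; apply/CN_sub/CN_sub.
  by apply/subsetP => _ /set2P[]->; rewrite mem_CN1 adj_sym.
have fact u v : u \in [set a; a'] -> adj u v -> adj a v -> adj a' v ->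
    c (CN (CN [set u])) (CN [set v]) =
    c (CN (CN [set u])) D (+) c D (CN [set v]).
  move=> uaa uv av a'v; rewrite cZ //.
  have [? ?] := aD u v uaa uv; have [? ?] := bD v av a'v.
  exact: lovasz_chain3.
rewrite !fact ?set21 ?set22 //.
by do 4!case: (c _ _); do 2!case: (s _).
Qed.

End EquivariantFunction.

(** * From an edge orientation of G to cochains on L(G) *)

Section OrientedIndex.
Variables (v0 : G) (g : G -> G -> bool).
Hypothesis g_orientation : edge_orientation g.

Definition base A : G := odflt v0 [pick v in A].

Lemma base_in A : A != set0 -> base A \in A.
Proof.
by rewrite /base; case: pickP => //= A0 /set0Pn[x]; rewrite A0.
Qed.

(** The base points of a concept and of its image span an edge, whose ends the involution
    exchanges. *)
Definition base_sign A : bool := g (base A) (base (CN A)).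

Lemma base_sign_act (A : lovasz G) : [set A] \in simplex (lovasz G) ->
  base_sign (@act (lovasz G) A) = ~~ base_sign A.
Proof.
move=> /lovasz_vertexP[A0 CA0 e]; rewrite /base_sign /= e.
by apply/g_orientation/(@in_CN A); apply: base_in.
Qed.

Hypothesis g_balanced : balanced g.

Definition chain_sign A B : bool := g (base A) (base (CN B)) (+) base_sign A.

(** Balancedness is applied to the base points of A and B on one side and of [CN B] and [CN C] on
    the other. *)
Lemma chain_signD A B C : concept A -> concept B -> concept C ->
  A \subset B -> B \subset C ->
  chain_sign A B (+) chain_sign B C = chain_sign A C.
Proof.
move=> [A0 CA0 _] [B0 CB0 _] [C0 CC0 _] AB BC.
have aB : base A \in B by rewrite (subsetP AB) ?base_in.
have cB : base (CN C) \in CN B by rewrite (subsetP (CN_sub BC)) ?base_in.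
have := g_balanced (in_CN aB (base_in CB0)) (in_CN aB cB)
   (in_CN (base_in B0) (base_in CB0)) (in_CN (base_in B0) cB).
rewrite /chain_sign /base_sign.
by do 5!case: (g _ _).
Qed.

(** A cocycle over F_2 is symmetric on simplices, so the formula for chains is used in both
    orders. *)
Definition cochain_sign A B : bool :=
  if A \subset B then chain_sign A B else chain_sign B A.

Lemma cochain_sign_ge A B : B \subset A -> cochain_sign A B = chain_sign B A.
Proof.
rewrite /cochain_sign; case: ifP => // AB BA.
by have -> : A = B by apply/eqP; rewrite eqEsubset AB.
Qed.

Lemma cochain_sign_le A B : A \subset B -> cochain_sign A B = chain_sign A B.
Proof. by rewrite /cochain_sign => ->. Qed.

(** Duality keeps the edge between [base A] and [base (CN B)] but exchanges its ends. *)
Lemma chain_sign_CN A B : concept A -> concept B -> A \subset B ->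
  chain_sign (CN B) (CN A) = chain_sign A B (+) base_sign A (+) base_sign B.
Proof.
move=> hA hB AB; have [A0 CA0 eA] := hA; have [B0 CB0 eB] := hB.
rewrite /chain_sign (base_sign_act (A := B)); last exact/lovasz_vertexP.
rewrite eA (@g_orientation (base A) (base (CN B))).
  by do 2!case: (base_sign _); case: (g _ _).
by apply: (@in_CN B); rewrite ?base_in // (subsetP AB) ?base_in.
Qed.

Lemma transfer_cochain_sign :
  transfer_cocycle (X := lovasz G) base_sign cochain_sign.
Proof.
split=> [A B C|A B] /lovaszP[cn cmp].
  have hA : concept A by apply: cn; rewrite !inE eqxx.
  have hB : concept B by apply: cn; rewrite !inE eqxx ?orbT.
  have hC : concept C by apply: cn; rewrite !inE eqxx ?orbT.
  have cmpAB : (A \subset B) || (B \subset A) by apply: cmp; rewrite !inE eqxx ?orbT.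
  have cmpBC : (B \subset C) || (C \subset B) by apply: cmp; rewrite !inE eqxx ?orbT.
  have cmpAC : (A \subset C) || (C \subset A) by apply: cmp; rewrite !inE eqxx ?orbT.
  have D := chain_signD.
  case/orP: cmpAB => AB; case/orP: cmpBC => BC.
  - by rewrite !cochain_sign_le ?D ?(subset_trans AB BC).
  - rewrite (cochain_sign_le AB) (cochain_sign_ge BC).
    case/orP: cmpAC => sAC;
      [rewrite (cochain_sign_le sAC)|rewrite (cochain_sign_ge sAC)].
      by rewrite -(D A C B) // addbK.
    by rewrite -(D C A B) // addbC addbK.
  - rewrite (cochain_sign_ge AB) (cochain_sign_le BC).
    case/orP: cmpAC => sAC;
      [rewrite (cochain_sign_le sAC)|rewrite (cochain_sign_ge sAC)].
      by rewrite -(D B A C) // addKb.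
    by rewrite -(D B C A) // addbAC addbb.
  - by rewrite !cochain_sign_ge ?(subset_trans BC AB) // addbC D.
have hA : concept A by apply: cn; rewrite !inE eqxx.
have hB : concept B by apply: cn; rewrite !inE eqxx ?orbT.
have cmpAB : (A \subset B) || (B \subset A) by apply: cmp; rewrite !inE eqxx ?orbT.
case/orP: cmpAB => AB /=.
  by rewrite cochain_sign_ge ?CN_sub // cochain_sign_le // chain_sign_CN.
by rewrite cochain_sign_le ?CN_sub // cochain_sign_ge // chain_sign_CN // addbAC.
Qed.

End OrientedIndex.

Lemma lovasz_dim2 : no_K23 G ->
  forall S : {set {set G}}, S \in simplex (lovasz G) -> #|S| <= 3.
Proof.
move=> K23 S /lovaszP[cn cmp].
(* In a chain at most one A has a single common neighbour, since nested singletons coincide; it gets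
   the value 0. The others have size 1 or 2, as K_{2,3} is excluded, and a chain has at most one
   member of each size. *)
pose f A : 'I_3 := inord (if #|CN A| <= 1 then 0 else #|A|).
have cardE A B : A \in S -> B \in S -> #|A| = #|B| -> A = B.
  move=> AS BS e; case/orP: (cmp _ _ AS BS) => AB; [|symmetry];
  by apply/eqP; rewrite eqEcard AB e leqnn.
have gt0 A : A \in S -> 0 < #|A| by case/cn; rewrite card_gt0.
have CNgt0 A : A \in S -> 0 < #|CN A| by case/cn; rewrite card_gt0.
have small A : A \in S -> 1 < #|CN A| -> #|A| < 3.
  move=> AS CA1; rewrite ltnNge; apply/negP => A3.
  by have := K23 _ _ CA1 A3; have [_ _ ->] := cn _ AS; rewrite subxx.
suff f_inj : {in S &, injective f}.
  by rewrite -(card_in_imset f_inj) -[X in _ <= X](card_ord 3) max_card.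
move=> A B AS BS; have [_ _ eA] := cn _ AS; have [_ _ eB] := cn _ BS.
move/(congr1 val); rewrite /f.
case: (leqP #|CN A| 1) => cA; case: (leqP #|CN B| 1) => cB /=;
  rewrite !inordK ?small //.
- move=> _; rewrite -eA -eB; congr CN.
  case/orP: (cmp _ _ AS BS) => /CN_sub AB; [symmetry|];
  by apply/eqP; rewrite eqEcard AB (leq_trans _ (CNgt0 _ _)).
- by have := gt0 _ BS; case: #|B|.
- by have := gt0 _ AS; case: #|A|.
- exact: cardE.
Qed.

End LovaszIndex.

(** * The index in terms of balanced orientations *)

Section LovaszConclusion.
Variables (G : sgraph) (v0 : G) (g : G -> G -> bool).
Hypotheses (g_orientation : edge_orientation g) (nonbip : ~ bipartite G)
  (K23 : no_K23 G).

Lemma cohom_ind_lovasz1 : balanced g -> cohom_ind_is (lovasz G) 1.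
Proof.
move=> g_bal; pose s := base_sign v0 g.
have s_act := base_sign_act v0 g_orientation.
exists (SW1 (X := lovasz G) s); first exact: SW1P.
split=> [/null_SW1_bipartite h|[|[|[|m]]] // _].
- exact/nonbip/h.
- apply/null_SW1_square => //; exists (cochain_sign v0 g).
  by apply: transfer_cochain_sign.
- by apply: null_SW1_ge3 => //; apply: lovasz_dim2.
Qed.

Lemma cohom_ind_lovasz2 :
  (forall h : G -> G -> bool, edge_orientation h -> ~ balanced h) ->
  cohom_ind_is (lovasz G) 2.
Proof.
move=> unbal; pose s := base_sign v0 g.
have s_act := base_sign_act v0 g_orientation.
exists (SW1 (X := lovasz G) s); first exact: SW1P.
split=> [/(null_SW1_square_orientation s_act)[h ho hb]|m m2].
  exact: unbal ho hb.
by apply: null_SW1_ge3 => //; apply: lovasz_dim2.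
Qed.

End LovaszConclusion.

(** * Closed walks modulo 2 *)

Section Parity.

Lemma odd_sum (I : Type) (r : seq I) (P : pred I) (E : I -> nat) :
  odd (\sum_(i <- r | P i) E i) = \big[addb/false]_(i <- r | P i) odd (E i).
Proof. exact: (big_morph odd oddD). Qed.

Lemma odd_count (T : Type) (P : pred T) (r : seq T) :
  odd (count P r) = \big[addb/false]_(x <- r) P x.
Proof.
rewrite -sumn_count sumnE big_map odd_sum.
by apply: eq_bigr => x _; rewrite oddb.
Qed.

Lemma big_addb_andr (I : Type) (r : seq I) (P : pred I) (E : I -> bool) b :
  \big[addb/false]_(i <- r | P i) (E i && b) =
  (\big[addb/false]_(i <- r | P i) E i) && b.
Proof.
case: b; rewrite ?andbT ?andbF; last by apply: big1 => i _; rewrite andbF.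
by apply: eq_bigr => i _; rewrite andbT.
Qed.

Lemma big_addb_andl (I : Type) (r : seq I) (P : pred I) (E : I -> bool) b :
  \big[addb/false]_(i <- r | P i) (b && E i) =
  b && (\big[addb/false]_(i <- r | P i) E i).
Proof. by rewrite andbC -big_addb_andr; apply: eq_bigr => i _; rewrite andbC. Qed.

Lemma big_addb_pick (T : finType) (P : pred T) x :
  \big[addb/false]_(y | P y) (y == x) = P x.
Proof.
rewrite big_mkcond (bigD1 x) //= eqxx big1 ?addbF; first by case: (P x).
by move=> y /negPf->; case: ifP.
Qed.

Definition same_edge (T : eqType) (u v a b : T) : bool :=
  ((a, b) == (u, v)) || ((a, b) == (v, u)).

Lemma same_edgeC (T : eqType) (u v a b : T) :
  same_edge u v a b = same_edge u v b a.
Proof. by rewrite /same_edge !xpair_eqE orbC andbC [X in _ || X]andbC. Qed.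

Lemma same_edge_swap (T : eqType) (u v a b : T) :
  same_edge u v a b = same_edge a b u v.
Proof.
by rewrite /same_edge !xpair_eqE !(eq_sym a) !(eq_sym b) [X in _ || X]andbC.
Qed.

Lemma big_same_edge (T : finType) (P : pred (T * T)) u v : u != v ->
  \big[addb/false]_(p | P p) same_edge u v p.1 p.2 = P (u, v) (+) P (v, u).
Proof.
move=> uv; rewrite -(big_addb_pick P (u, v)) -(big_addb_pick P (v, u)) -big_split.
apply: eq_bigr => -[a b] _; rewrite /same_edge /=.
by case: eqP => //= -[-> ->]; rewrite xpair_eqE (negPf uv).
Qed.

Lemma big_swap (T : finType) (P : pred (T * T)) (E : T * T -> bool) :
  \big[addb/false]_(p | P p) E p =
  \big[addb/false]_(p | P (p.2, p.1)) E (p.2, p.1).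
Proof.
by rewrite (reindex_inj (h := fun p : T * T => (p.2, p.1))) // => -[a b] [c d] [-> ->].
Qed.

End Parity.

Section Walks.
Variable G : sgraph.
Implicit Types (f : G -> G -> bool) (x y u v : G).

Definition walk_steps x (p : seq G) : seq (G * G) := zip (belast x p) p.

Definition walk_parity x p u v : bool :=
  odd (count (fun q => same_edge u v q.1 q.2) (walk_steps x p)).

(** Here f is the 1-chain modulo 2 of a walk from x to y; only this chain is remembered. *)
Definition realizes x y f : Prop :=
  exists p, [/\ path (@adj G) x p, last x p = y & walk_parity x p =2 f].

Lemma realizes_ext x y f f' : f =2 f' -> realizes x y f -> realizes x y f'.
Proof. by move=> e [p [h1 h2 h3]]; exists p; split=> // u v; rewrite h3. Qed.

Lemma realizes_nil x : realizes x x (fun _ _ => false).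
Proof. by exists [::]. Qed.

Lemma realizes_edge x y : adj x y -> realizes x y (same_edge x y).
Proof.
move=> xy; exists [:: y]; split=> //=; first by rewrite xy.
by move=> u v; rewrite /walk_parity /= addn0 oddb same_edge_swap.
Qed.

Lemma realizes_cat x y z f f' : realizes x y f -> realizes y z f' ->
  realizes x z (fun u v => f u v (+) f' u v).
Proof.
move=> [p [p1 p2 p3]] [q [q1 q2 q3]]; exists (p ++ q); split.
- by rewrite cat_path p1 p2.
- by rewrite last_cat p2.
move=> u v; rewrite -p3 -q3 /walk_parity /walk_steps belast_cat p2.
by rewrite zip_cat ?size_belast // count_cat oddD.
Qed.

Lemma realizes_rev x y f : realizes x y f -> realizes y x f.
Proof.
case=> p [+ + /realizes_ext]; set f' := walk_parity x p => p1 p2; apply.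
rewrite {}/f'; elim: p x p1 p2 => [x _ <-|z p IH x /= /andP[xz zp] e].
  exact: realizes_nil.
have zx : adj z x by rewrite adj_sym.
apply: realizes_ext (realizes_cat (IH z zp e) (realizes_edge zx)) => u v.
rewrite /walk_parity /= oddD oddb addbC; congr (_ (+) _).
by rewrite same_edge_swap same_edgeC.
Qed.

Lemma realizes_big (I : eqType) (r : seq I) x (E : I -> G -> G -> bool) :
  {in r, forall i, realizes x x (E i)} ->
  realizes x x (fun u v => \big[addb/false]_(i <- r) E i u v).
Proof.
elim: r => [_|i r IH h].
  by apply: realizes_ext (realizes_nil x) => u v; rewrite big_nil.
have h1 := h i (mem_head _ _).
have h2 : realizes x x (fun u v => \big[addb/false]_(i <- r) E i u v).
  by apply: IH => j jr; apply: h; rewrite inE jr orbT.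
by apply: realizes_ext (realizes_cat h1 h2) => u v; rewrite big_cons.
Qed.

Lemma realizes_closed_walk x f : realizes x x f ->
  exists2 c, closed_walk c & forall u v, odd (multiplicity c u v) = f u v.
Proof.
case=> p; case/lastP: p => [|p y] [p1 p2 p3]; first by exists [::].
rewrite last_rcons in p2; subst y; exists (x :: p) => // u v.
rewrite -p3 /walk_parity /walk_steps belast_rcons /multiplicity /steps rot1_cons.
by congr odd; apply: eq_count => -[a b].
Qed.

(* Going from v0 along the path P u to u, along the edge uv and back along P v,
   for all the edges uv of m, each P u is used an even number of times. *)
Lemma realizes_even (g m : G -> G -> bool) (v0 : G) :
  (forall v, connect (@adj G) v0 v) -> edge_orientation g ->
  (forall u v, m u v -> adj u v) -> symmetric m ->
  (forall v, \big[addb/false]_t m v t = false) -> realizes v0 v0 m.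
Proof.
move=> conn go m_adj m_sym m_even.
have [f hf] : exists f : G -> G -> G -> bool, forall v, realizes v0 v (f v).
  apply: (fin_all_exists (P := fun v f => realizes v0 v f)) => v.
  by have /connectP[p p1 p2] := conn v; exists (walk_parity v0 p), p.
pose E (p : G * G) u v := f p.1 u v (+) (same_edge p.1 p.2 u v (+) f p.2 u v).
(* [g] selects one direction of every edge of [m]. *)
pose M : pred (G * G) := fun p => m p.1 p.2 && g p.1 p.2.
have : realizes v0 v0 (fun u v => \big[addb/false]_(p <- enum M) E p u v).
  apply: realizes_big => -[a b]; rewrite mem_enum => /andP[/= mab _].
  apply: realizes_cat (hf a) _; apply: realizes_cat (realizes_rev (hf b)).
  exact/realizes_edge/m_adj.
apply: realizes_ext => u v; rewrite big_enum /= /E big_split /= addbC big_split /=.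
rewrite -addbA addbC [X in X (+) _](_ : _ = false) /=; last first.
  (* [M] and its swapped pairs exhaust [m]; grouped by first end, the path to a vertex occurs once
     per edge of [m] at it, hence an even number of times. *)
  rewrite [X in X (+) _]big_swap /=.
  transitivity (\big[addb/false]_(p : G * G | m p.1 p.2) f p.1 u v).
    rewrite [RHS](bigID (fun p => g p.1 p.2)) /= [RHS]addbC; congr (_ (+) _).
    apply: eq_bigl => -[a b]; rewrite unfold_in /M /= m_sym.
    by case: (boolP (m a b)) => //= /m_adj/go ->.
  rewrite -(pair_big_dep xpredT m (fun a _ => f a u v)) /=.
  apply: big1 => a _; rewrite big_mkcond.
  transitivity ((\big[addb/false]_t m a t) && f a u v); last by rewrite m_even.
  by rewrite -big_addb_andr; apply: eq_bigr => t _; case: (m a t).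
under eq_bigr do rewrite same_edge_swap.
have [uv|Nuv] := boolP (adj u v).
  rewrite big_same_edge; last by apply: contraTneq uv => ->; rewrite adj_irr.
  by rewrite !unfold_in /M /= (m_sym v) (go u v) //; case: (m u v); case: (g u v).
have /negPf-> : ~~ m u v by apply: contra Nuv; apply: m_adj.
apply: big1 => -[a b] /andP[/= /m_adj ab _]; apply: contraNF Nuv.
rewrite /same_edge !xpair_eqE => /orP[] /andP[/eqP <- /eqP <-] //.
by rewrite adj_sym.
Qed.

End Walks.

(** * Quadrangulations *)

Lemma on_cycleC (T : eqType) (c : seq T) u v : on_cycle c u v = on_cycle c v u.
Proof. exact: orbC. Qed.

Lemma on_cycle4 (T : eqType) (a b a' b' u v : T) :
  on_cycle [:: a; b; a'; b'] u v =
  (u \in [:: a; a']) && (v \in [:: b; b']) ||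
  (u \in [:: b; b']) && (v \in [:: a; a']).
Proof.
rewrite /on_cycle /steps /= !inE !xpair_eqE.
by do 4!case: (u == _); do 4!case: (v == _).
Qed.

Section Quadrangulation.
Variables (G : sgraph) (F : finType) (bd : F -> seq G).
Hypothesis hquad : quadrangulation bd.
Implicit Types (u v a b : G) (f h k : F) (g e : G -> G -> bool).

Let surf : closed_surface bd := proj1 hquad.

Lemma on_cycle_adj f u v : on_cycle (bd f) u v -> adj u v.
Proof.
have /and3P[wf _ _] := bd_cycle surf f.
by case/orP=> /(step_adj wf) //; rewrite adj_sym.
Qed.

Lemma steps_bd_adj f p : p \in steps (bd f) -> adj p.1 p.2.
Proof. by case: p => u v uv; apply: (@on_cycle_adj f); rewrite /on_cycle uv. Qed.

Lemma uniq_steps_bd f : uniq (steps (bd f)).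
Proof. by have /and3P[_ ? _] := bd_cycle surf f; apply: steps_uniq. Qed.

Lemma size_steps_bd f : size (steps (bd f)) = 4.
Proof. by rewrite size_zip size_rot minnn; case: hquad. Qed.

Lemma bd4 f : exists a b a' b', [/\ bd f = [:: a; b; a'; b'],
  [/\ adj a b, adj a b', adj a' b & adj a' b'], a != a' & b != b'].
Proof.
have := bd_cycle surf f; have := proj2 hquad f.
case: (bd f) => [|a [|b [|a' [|b' []]]]] //= _ /and3P[+ + _].
rewrite /closed_walk /= andbT => /and4P[ab ba' a'b' b'a].
rewrite !inE !negb_or => /and4P[/and3P[_ aa' _] /andP[_ bb'] _ _].
by exists a, b, a', b'; split=> //; split=> //; rewrite adj_sym.
Qed.

(** For an edge orientation, the parity of the forward edges around the face; for a symmetric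
    function, the value of its coboundary on the face. *)
Definition face_sum g f : bool :=
  \big[addb/false]_(p <- steps (bd f)) g p.1 p.2.

Lemma face_sumE g f a b a' b' : bd f = [:: a; b; a'; b'] ->
  face_sum g f = g a b (+) g b a' (+) g a' b' (+) g b' a.
Proof.
by move=> e; rewrite /face_sum e /steps /= !big_cons big_nil addbF !addbA.
Qed.

Lemma face_sumD g e f :
  face_sum (fun u v => g u v (+) e u v) f = face_sum g f (+) face_sum e f.
Proof. exact: big_split. Qed.

Lemma balanced_face_sum g f :
  edge_orientation g -> balanced g -> face_sum g f = false.
Proof.
move=> go gb; have [a [b [a' [b' [e [ab ab' a'b a'b'] _ _]]]]] := bd4 f.
rewrite (face_sumE _ e) (go a' b) // (go a b') //.
have := gb _ _ _ _ ab ab' a'b a'b'.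
by case: (g a b); case: (g a b'); case: (g a' b); case: (g a' b').
Qed.

(** * Consequences of every 4-cycle being facial *)

Section Facial.
Hypothesis hfacial : forall c, graph_cycle c -> size c = 4 -> facial bd c.

Lemma facial4 a a' b b' : a != a' -> b != b' ->
  adj a b -> adj a b' -> adj a' b -> adj a' b' ->
  exists f, forall u v, on_cycle (bd f) u v = on_cycle [:: a; b; a'; b'] u v.
Proof.
move=> aa' bb' ab ab' a'b a'b'; apply: hfacial => //.
have neq u v : adj u v -> u != v.
  by move=> uv; apply: contraTneq uv => ->; rewrite adj_irr.
rewrite /graph_cycle /closed_walk /= ab (adj_sym b) a'b a'b' (adj_sym b') ab' /=.
by rewrite !inE !negb_or aa' bb' !neq // adj_sym.
Qed.

Lemma face_sum_balanced g : edge_orientation g ->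
  (forall f, face_sum g f = false) -> balanced g.
Proof.
move=> go gf a a' b b' ab ab' a'b a'b'.
have [->//|aa'] := eqVneq a a'; have [->|bb'] := eqVneq b b'.
  by rewrite !addbb.
have [f hf] := facial4 aa' bb' ab ab' a'b a'b'.
have [w0 [w1 [w2 [w3 [e _ w02 w13]]]]] := bd4 f.
have := gf f; rewrite (face_sumE _ e).
have ab0 u : u \in [:: a; a'] -> u \in [:: b; b'] -> false.
  by rewrite !inE => /orP[] /eqP-> /orP[] /eqP eab;
    move: ab ab' a'b a'b'; rewrite eab adj_irr.
have on01 : on_cycle (bd f) w0 w1 by rewrite e on_cycle4 !inE !eqxx.
have on21 : on_cycle (bd f) w2 w1 by rewrite e on_cycle4 !inE !eqxx !orbT.
have on23 : on_cycle (bd f) w2 w3 by rewrite e on_cycle4 !inE !eqxx !orbT.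
move: on01 on21 on23; rewrite !hf !on_cycle4.
(* The face has the edges of the 4-cycle, but its boundary may be listed from any vertex and in
   either direction; [ab0] rules out mixing the two sides. *)
move=> /orP[] /andP[h0 h1] /orP[] /andP[h2 h1'] /orP[] /andP[h2' h3];
  try by [case: (ab0 _ h1 h1')|case: (ab0 _ h1' h1)
         |case: (ab0 _ h2 h2')|case: (ab0 _ h2' h2)].
all: move: w02 w13 h0 h1 h2 h3; rewrite !inE => w02 w13.
all: move=> /orP[] /eqP ? /orP[] /eqP ? /orP[] /eqP ? /orP[] /eqP ?; subst;
  rewrite ?eqxx // in w02 w13 *.
all: rewrite ?(go a b) // ?(go a b') // ?(go a' b) // ?(go a' b') //.
all: by case: (g a b); case: (g a b'); case: (g a' b); case: (g a' b').
Qed.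

Lemma adj_neq u v : adj u v -> u != v.
Proof. by move=> uv; apply: contraTneq uv => ->; rewrite adj_irr. Qed.

(* The two 4-cycles of the K_{2,3} through one of its edges are the two faces
   at this edge. *)
Lemma K23_face (A B : {set G}) a b f : 1 < #|A| -> 2 < #|B| ->
  (forall x y, x \in A -> y \in B -> adj x y) -> a \in A -> b \in B ->
  on_cycle (bd f) a b -> forall u v, on_cycle (bd f) u v ->
  (u \in A) && (v \in B) || (u \in B) && (v \in A).
Proof.
move=> A2 B3 AB aA bB fab.
have [a' ] : exists a', a' \in A :\ a.
  by apply/set0Pn; rewrite -card_gt0; rewrite (cardsD1 a) aA in A2.
rewrite !inE eq_sym => /andP[aa' a'A].
have [b2 [b3 []]] : exists b2 b3, [/\ b2 \in B :\ b, b3 \in B :\ b & b2 != b3].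
  by apply/card_gt1P; rewrite (cardsD1 b) bB in B3.
rewrite !inE !(eq_sym _ b) => /andP[bb2 b2B] /andP[bb3 b3B] b23.
have [f2 h2] := facial4 aa' bb2 (AB _ _ aA bB) (AB _ _ aA b2B)
  (AB _ _ a'A bB) (AB _ _ a'A b2B).
have [f3 h3] := facial4 aa' bb3 (AB _ _ aA bB) (AB _ _ aA b3B)
  (AB _ _ a'A bB) (AB _ _ a'A b3B).
have f23 : f2 != f3.
  apply/eqP => e23; have := h2 a b2; rewrite e23 h3 !on_cycle4 !inE !eqxx.
  rewrite (eq_sym b2 b) (negPf bb2) (negPf b23) !orbT /=.
  by rewrite (negPf (adj_neq (AB _ _ aA bB))) (negPf (adj_neq (AB _ _ aA b3B))).
have sub : [set f2; f3] \subset [set f | on_cycle (bd f) a b].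
  by apply/subsetP => k /set2P[]->; rewrite inE ?h2 ?h3 on_cycle4 !inE !eqxx.
have : f \in [set f2; f3].
  have /eqP-> : [set f2; f3] == [set f | on_cycle (bd f) a b].
    by rewrite eqEcard sub cards2 f23 (edge_faces surf (AB _ _ aA bB)).
  by rewrite inE.
case/set2P=> -> u v; rewrite ?h2 ?h3 on_cycle4 !inE;
by case/orP=> /andP[/orP[] /eqP-> /orP[] /eqP->];
  rewrite ?aA ?a'A ?bB ?b2B ?b3B ?orbT.
Qed.

(** A face with one edge in the K_{2,3} has all its edges there. By connectedness of links the same
    holds for all edges at its vertices, and by connectedness G is all of it, hence bipartite. *)
Lemma quadrangulation_no_K23 : ~ bipartite G -> no_K23 G.
Proof.
move=> nonbip A B A2 B3; apply/negP => /subsetP BA; apply: nonbip.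
have AB x y : x \in A -> y \in B -> adj x y.
  by move=> xA /BA; apply: in_CN.
pose K u v := (u \in A) && (v \in B) || (u \in B) && (v \in A).
have Kadj u v : K u v -> adj u v.
  by case/orP=> /andP[? ?]; [|rewrite adj_sym]; apply: AB.
have face u v f x y : K u v -> on_cycle (bd f) u v -> on_cycle (bd f) x y -> K x y.
  case/orP=> /andP[hu hv] fuv; first exact: K23_face fuv _ _.
  by rewrite on_cycleC in fuv; apply: K23_face fuv _ _.
have K_nbhd u v : (u \in A) || (u \in B) -> adj u v -> K u v.
  move=> uAB uv; have [w Kuw] : exists w, K u w.
    case/orP: uAB => [uA|uB].
      have /card_gt0P[b bB] : 0 < #|B| by apply: ltn_trans B3.
      by exists b; rewrite /K uA bB.
    have /card_gt0P[a aA] : 0 < #|A| by apply: ltn_trans A2.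
    by exists a; rewrite /K uB aA orbT.
  have /connectP[p + ->] := link_connected surf (Kadj _ _ Kuw) uv.
  elim: p w Kuw {uv} => [//|x p IH] w Kuw /= /andP[/existsP[f /andP[fwu fux]]].
  by apply: IH; apply: face Kuw _ fux; rewrite on_cycleC.
have [a aA] : exists a, a \in A by apply/card_gt0P/(ltn_trans _ A2).
have all_AB v : (v \in A) || (v \in B).
  have /connectP[p + ->] := surface_connected surf a v.
  have : (a \in A) || (a \in B) by rewrite aA.
  elim: p a {aA} => [//|x p IH] u uAB /= /andP[/(K_nbhd _ _ uAB) Kux].
  by apply: IH; case/orP: Kux => /andP[_ ->]; rewrite ?orbT.
have disj v : v \in A -> v \in B -> False.
  by move=> vA vB; have := AB _ _ vA vB; rewrite adj_irr.
exists (fun v => v \in A) => u v /(K_nbhd _ _ (all_AB u)) /orP[] /andP[hu hv].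
  by rewrite hu; apply/negP => /eqP/esym/disj/(_ hv).
by rewrite hv; apply/negP => /eqP/disj/(_ hu).
Qed.

End Facial.
End Quadrangulation.

(** * Linear equations of the faces modulo 2 *)

Section Counting.
Variables (G : sgraph) (F : finType) (bd : F -> seq G).
Hypothesis hquad : quadrangulation bd.
Implicit Types (u v a b : G) (f h k : F) (g e : G -> G -> bool).

Let surf : closed_surface bd := proj1 hquad.

(** For an edge orientation this lists every undirected edge exactly once. *)
Definition edges g : pred (G * G) := fun p => adj p.1 p.2 && g p.1 p.2.

Lemma edges_swap g u v : edge_orientation g -> adj u v ->
  edges g (u, v) (+) edges g (v, u).
Proof.
by move=> go uv; rewrite /edges /= (adj_sym v) uv (go u v) //; case: (g u v).
Qed.

Lemma odd_size_walk g c : edge_orientation g -> closed_walk c ->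
  odd (size c) = \big[addb/false]_(p | edges g p) odd (multiplicity c p.1 p.2).
Proof.
move=> go wc.
transitivity (\big[addb/false]_(p | edges g p)
    \big[addb/false]_(q <- steps c) same_edge q.1 q.2 p.1 p.2); last first.
  apply: eq_bigr => -[u v] _; rewrite /multiplicity odd_count.
  by apply: eq_bigr => -[a b] _; rewrite same_edge_swap.
rewrite exchange_big /= (_ : size c = size (steps c)); last first.
  by rewrite size_zip size_rot minnn.
rewrite -count_predT odd_count; apply: eq_big_seq => -[u v] /(step_adj wc) uv.
by rewrite big_same_edge ?(adj_neq uv) //= (edges_swap go uv).
Qed.

Lemma sum_mem_uniq (P : pred (G * G)) (r : seq (G * G)) : uniq r ->
  \sum_(p | P p) (p \in r) = count P r.
Proof.
move=> Ur; rewrite -sum1_count big_mkcond [RHS]big_mkcond [RHS]big_uniq //=.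
rewrite [RHS]big_mkcond; apply: eq_bigr => p _.
by case: (P p); case: (p \in r).
Qed.

Lemma odd_traverses g o f : edge_orientation g ->
  odd (\sum_(p | edges g p) traverses bd o f p.1 p.2) = face_sum bd g f.
Proof.
move=> go; rewrite /traverses; have Uf := uniq_steps_bd hquad f.
have adjf p : p \in steps (bd f) -> adj p.1 p.2 by apply: steps_bd_adj.
case: (o f).
  under eq_bigr do rewrite -surjective_pairing.
  rewrite sum_mem_uniq // odd_count; apply: eq_big_seq => p /adjf pa.
  by rewrite /edges pa.
rewrite (reindex_inj (h := fun p : G * G => (p.2, p.1))) /=; last first.
  by move=> [? ?] [? ?] [-> ->].
under eq_bigr do rewrite -surjective_pairing.
rewrite sum_mem_uniq //.
have -> : count (fun p => edges g (p.2, p.1)) (steps (bd f)) =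
    count (predC (fun p => g p.1 p.2)) (steps (bd f)).
  apply: eq_in_count => p /adjf pa.
  by rewrite /edges /= adj_sym pa (go p.1 p.2).
rewrite /face_sum -(odd_count (fun p : G * G => g p.1 p.2)).
(* A face has four edges, so its forward and backward edges agree in parity and reversing it does no
   harm. *)
have := count_predC (fun p => g p.1 p.2) (steps (bd f)).
rewrite (size_steps_bd hquad) => /(congr1 odd); rewrite oddD /=.
by case: (odd _); case: (odd _).
Qed.

Let runs (o : F -> bool) u v : nat := \sum_f traverses bd o f u v.

Lemma odd_runs o u v : adj u v -> odd (runs o u v) = coherent bd o u v.
Proof.
move=> uv; rewrite (coherentE surf o uv); move: (runsD surf o uv).
rewrite -/(runs o u v) -/(runs o v u).
by case: (runs o u v) => [|[|[|?]]] //; case: (runs o v u) => [|[|[|?]]].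
Qed.

Lemma sum_edges_swap g (E : G * G -> nat) : edge_orientation g ->
  \sum_(p | edges g p) (E p + E (p.2, p.1)) = \sum_(p | adj p.1 p.2) E p.
Proof.
move=> go; rewrite big_split /= [RHS](bigID (fun p => g p.1 p.2)) /=; congr addn.
rewrite (reindex_inj (h := fun p : G * G => (p.2, p.1))) /=; last first.
  by move=> [? ?] [? ?] [-> ->].
apply: eq_big => [[u v]|[u v] //]; rewrite /edges /= adj_sym.
by case: (boolP (adj u v)) => //= /go ->.
Qed.

(** Each edge lies on two faces and each face has four edges, so there are twice as many edges as
    faces. *)
Lemma even_edges g : edge_orientation g ->
  \big[addb/false]_(p | edges g p) true = false.
Proof.
move=> go; pose o (f : F) := true.
have : \sum_(p | edges g p) 2 = \sum_(f : F) 4.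
  transitivity (\sum_(p | edges g p) (runs o p.1 p.2 + runs o p.2 p.1)).
    by apply: eq_bigr => p /andP[pa _]; rewrite (runsD surf o pa).
  rewrite (sum_edges_swap (fun p => runs o p.1 p.2)) // exchange_big /=.
  apply: eq_bigr => f _; rewrite /traverses /=.
  under eq_bigr do rewrite -surjective_pairing.
  rewrite sum_mem_uniq ?uniq_steps_bd // -(size_steps_bd hquad f).
  by apply/eqP; rewrite -all_count; apply/allP => p; apply: steps_bd_adj.
rewrite !sum_nat_const => e2.
have {e2} : #|edges g| * 2 = #|F| * 4 by [].
rewrite -[4]/(2 * 2) mulnA => /eqP; rewrite eqn_pmul2r // mulnC => /eqP.
move=> /(congr1 odd); rewrite oddM -sum1_card odd_sum /= => e2.
by rewrite -[RHS]e2; apply: eq_bigl.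
Qed.

(** Double counting: a forward edge is traversed an odd number of times iff it is coherent. Evenness
    of the number of edges then replaces coherent by incoherent. *)
Lemma face_sums_incoherent g o : edge_orientation g ->
  \big[addb/false]_f face_sum bd g f =
  \big[addb/false]_(p | edges g p) ~~ coherent bd o p.1 p.2.
Proof.
move=> go; transitivity (odd (\sum_(p | edges g p) runs o p.1 p.2)).
  rewrite exchange_big /= odd_sum; apply: eq_bigr => f _.
  by rewrite odd_traverses.
rewrite odd_sum; transitivity
  ((\big[addb/false]_(p | edges g p) odd (runs o p.1 p.2)) (+)
   (\big[addb/false]_(p | edges g p) true)); first by rewrite even_edges ?addbF.
rewrite -big_split /=.
by apply: eq_bigr => p /andP[pa _]; rewrite odd_runs // addbT.
Qed.

(** Oriented faces enter and leave v equally often, and each edge at v is traversed twice in all, so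
    the number of departures is the degree of v; along a single edge it is odd iff the edge is
    coherent. *)
Lemma incoherent_even o v :
  \big[addb/false]_t (adj v t && ~~ coherent bd o v t) = false.
Proof.
have := runs_balance surf o v.
rewrite -/(\sum_t runs o t v) -/(\sum_t runs o v t) => bal.
have e : \sum_t runs o v t = \sum_t adj v t.
  apply/eqP; rewrite -(eqn_pmul2l (ltn0Sn 1)) mul2n -addnn -{1}bal -big_split /=.
  rewrite big_distrr /=; apply/eqP/eq_bigr => t _.
  case: (boolP (adj v t)) => [vt|Nvt]; first by rewrite addnC (runsD surf).
  by rewrite /runs !(runs_nonadj surf) // adj_sym.
have := congr1 odd e; rewrite !odd_sum => eo.
transitivity ((\big[addb/false]_t odd (runs o v t)) (+)
              (\big[addb/false]_t odd (adj v t))); last by rewrite eo addbb.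
rewrite -big_split /=; apply: eq_bigr => t _; rewrite oddb.
case: (boolP (adj v t)) => [vt|Nvt] /=; first by rewrite odd_runs // addbT.
by rewrite /runs (runs_nonadj surf).
Qed.

Lemma incoherent_walk o (v0 : G) g : edge_orientation g ->
  exists2 c : seq G, closed_walk c &
    forall u v, adj u v -> coherent bd o u v = ~~ odd (multiplicity c u v).
Proof.
move=> go.
have m_sym : symmetric (fun u v => adj u v && ~~ coherent bd o u v).
  by move=> u v; rewrite adj_sym coherent_sym.
have [] := realizes_closed_walk (realizes_even (surface_connected surf v0) go
  _ m_sym (incoherent_even o)).
  by move=> u v /andP[].
move=> c wc hc; exists c => // u v uv.
by rewrite hc uv negbK.
Qed.

(** Such an e arises as the set of edges crossed by a path from f to h in the dual graph. *)
Definition homologous_faces f h : Prop := exists2 e : G -> G -> bool,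
  forall u v, e u v = e v u & forall k, face_sum bd e k = (k == f) (+) (k == h).

Lemma homologous_refl f : homologous_faces f f.
Proof.
by exists (fun _ _ => false) => // k; rewrite addbb /face_sum big1.
Qed.

Lemma homologous_trans f h k :
  homologous_faces f h -> homologous_faces h k -> homologous_faces f k.
Proof.
move=> [e e1 e2] [d d1 d2]; exists (fun u v => e u v (+) d u v) => [u v|l].
  by rewrite e1 d1.
by rewrite face_sumD e2 d2 addbA addbK.
Qed.

Lemma homologous_edge f h u v :
  on_cycle (bd f) u v -> on_cycle (bd h) u v -> homologous_faces f h.
Proof.
move=> fuv huv; have uv := on_cycle_adj hquad fuv.
have [->|fh] := eqVneq f h; first exact: homologous_refl.
exists (same_edge u v) => [a b|k]; first exact: same_edgeC.
have /and3P[_ Uk k2] := bd_cycle surf k.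
transitivity (on_cycle (bd k) u v).
  rewrite -[RHS]oddb -multiplicity_cycle ?(adj_neq uv) // odd_count.
  by apply: eq_bigr => -[a b] _.
have : [set f; h] == [set f | on_cycle (bd f) u v].
  rewrite eqEcard cards2 fh (edge_faces surf uv) leqnn andbT.
  by apply/subsetP => l /set2P[]->; rewrite inE.
move/eqP/setP/(_ k); rewrite !inE => <-.
by case: eqP => //= ->; rewrite (negPf fh).
Qed.

Lemma homologous_vertex f h v : v \in bd f -> v \in bd h -> homologous_faces f h.
Proof.
have side k : v \in bd k -> exists u, on_cycle (bd k) v u.
  have [a [b [a' [b' [-> _ _ _]]]]] := bd4 hquad k.
  rewrite !inE => /or4P[] /eqP->; [exists b|exists a|exists b|exists a];
  by rewrite on_cycle4 !inE !eqxx ?orbT.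
move=> /side[u fu] /side[w hw].
have /connectP[p + wE] :=
  link_connected surf (on_cycle_adj hquad fu) (on_cycle_adj hquad hw).
rewrite {}wE in hw; elim: p u f fu hw => [|x p IH] u f fu hw /=.
  by move=> _; apply: homologous_edge fu hw.
case/andP=> /existsP[k /andP[kuv kvx]] xp; rewrite on_cycleC in kuv.
exact: homologous_trans (homologous_edge fu kuv) (IH x k kvx hw xp).
Qed.

Lemma homologous_connected f h : homologous_faces f h.
Proof.
have vtx k : exists v, v \in bd k.
  have [a [b [a' [b' [-> _ _ _]]]]] := bd4 hquad k.
  by exists a; rewrite mem_head.
have [u uf] := vtx f; have [v vh] := vtx h.
have /connectP[p + vE] := surface_connected surf u v.
rewrite {}vE in vh; elim: p u f uf vh => [|x p IH] u f uf vh /=.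
  by move=> _; apply: homologous_vertex uf vh.
case/andP=> ux xp.
have [k] : exists k, k \in [set f | on_cycle (bd f) u x].
  by apply/card_gt0P; rewrite (edge_faces surf ux).
rewrite inE => kux.
have [uk xk] : u \in bd k /\ x \in bd k.
  have [a [b [a' [b' [e _ _ _]]]]] := bd4 hquad k; move: kux; rewrite e on_cycle4.
  rewrite !inE => /orP[] /andP[/orP[] /eqP-> /orP[] /eqP->];
  by rewrite !eqxx ?orbT.
exact: homologous_trans (homologous_vertex uf uk) (IH x k xk vh xp).
Qed.

(** Every face of z is joined to [f0]; the contributions at [f0] cancel because z has even
    weight. *)
Lemma face_sums_onto (f0 : F) (z : F -> bool) :
  \big[addb/false]_f z f = false ->
  exists2 e : G -> G -> bool, forall u v, e u v = e v u &
    forall k, face_sum bd e k = z k.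
Proof.
move=> z0; have [e he] : exists e : F -> G -> G -> bool, forall f,
    (forall u v, e f u v = e f v u) /\
    (forall k, face_sum bd (e f) k = (k == f) (+) (k == f0)).
  apply: (fin_all_exists (P := fun f (e : G -> G -> bool) =>
     (forall u v, e u v = e v u) /\
     (forall k, face_sum bd e k = (k == f) (+) (k == f0)))) => f.
  by have [e e1 e2] := homologous_connected f f0; exists e.
exists (fun u v => \big[addb/false]_f (z f && e f u v)) => [u v|k].
  by apply: eq_bigr => f _; rewrite (proj1 (he f)).
rewrite /face_sum exchange_big /=.
transitivity (\big[addb/false]_f ((z f && (f == k)) (+) (z f && (k == f0)))).
  apply: eq_bigr => f _; rewrite big_addb_andl -/(face_sum bd (e f) k).
  by rewrite (proj2 (he f)) (eq_sym k f) andb_addr.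
rewrite big_split /= big_addb_andr z0 addbF.
rewrite -(big_addb_pick z k) [RHS]big_mkcond; apply: eq_bigr => f _.
by case: (z f).
Qed.

End Counting.

Theorem theorem5p1 (G : sgraph) (F : finType) (bd : F -> seq G)
    (hquad : quadrangulation bd)
    (hnonor : ~ orientable bd)
    (hnonbip : ~ bipartite G)
    (hfacial : forall c : seq G, graph_cycle c -> size c = 4 -> facial bd c) :
  (odd_quadrangulation bd -> cohom_ind_is (lovasz G) 2) /\
  (~ odd_quadrangulation bd -> cohom_ind_is (lovasz G) 1).
Proof.
have K23 := quadrangulation_no_K23 hquad hfacial hnonbip.
have [v0 _] : exists v0 : G, true.
  case: (pickP (@predT G)) => [v _|G0]; first by exists v.
  by case: hnonbip; exists xpredT => u; have := G0 u.
pose g0 (u v : G) := enum_rank u < enum_rank v.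
have g0_orientation : edge_orientation g0.
  move=> u v uv; rewrite /g0 -leqNgt [RHS]leq_eqVlt.
  by case: eqP => [/val_inj/enum_rank_inj e|//]; rewrite e adj_irr in uv.
split=> [[c [wc oc [o ho]]]|not_odd].
  (* Balancedness makes all face sums 0, so the number of incoherent edges is even; but c runs an
     odd number of times along exactly these edges, so this number has the parity of its odd
     length. *)
  apply: (cohom_ind_lovasz2 v0 g0_orientation K23) => g go gb.
  move: oc; rewrite (odd_size_walk go wc).
  under eq_bigr => p /andP[pa _] do rewrite -[odd _]negbK -ho //.
  rewrite -(face_sums_incoherent hquad o go) big1 // => f _.
  exact: balanced_face_sum.
(* Any orientations of the faces would do; the constant choice is taken. *)
have [c wc hc] := incoherent_walk hquad (fun=> true) v0 g0_orientation.
have even_c : odd (size c) = false.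
  by apply/negP => oc; apply: not_odd; exists c; split=> //; exists (fun=> true).
have even_faces : \big[addb/false]_f face_sum bd g0 f = false.
  rewrite (face_sums_incoherent hquad (fun=> true) g0_orientation) -[RHS]even_c.
  rewrite (odd_size_walk g0_orientation wc); apply: eq_bigr => p /andP[pa _].
  by rewrite hc // negbK.
have [f0 _] := vert_face (proj1 hquad) v0.
have [e e_sym he] := face_sums_onto hquad f0 even_faces.
(* Reversing the edges of [e] cancels every face sum, and symmetry of [e] keeps this an edge
   orientation. *)
pose g u v := g0 u v (+) e u v.
have go : edge_orientation g.
  by move=> u v uv; rewrite /g (g0_orientation u v uv) e_sym addNb.
apply: (cohom_ind_lovasz1 v0 go hnonbip K23).
apply: (face_sum_balanced hquad hfacial go) => f.
by rewrite face_sumD he addbb.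
Qed.
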